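(* Let $\lambda(x,\xi,t)$ be a scattering frame (for the hard-sphere Boltzmann collision operator $Q$) with isotropic radius $\alpha$, and let $\|\cdot\|_O$, $\|\cdot\|_S$, $S(C)$ be the observer's norm, scattering norm and scattering spaces associated to $\lambda$. Let $0<N<\alpha$. (1) For any initial value $f_0$ (with finite mass, energy and momentum) such that $f_0(x-t\xi,\xi)\in S(\tfrac12N)$, there exists a unique scattering solution $f\in S(N)$ of the Boltzmann equation $$\partial_t f(x,\xi,t)+\xi\cdot\nabla_x f(x,\xi,t)=Q(f,f)(x,\xi,t),\qquad f(x,\xi,0)=f_0(x,\xi).$$ This solution scatters to a unique solution $f_\infty\in S(N)$ of the linear transport equation: for every compact $D\subset\mathbb{R}^n$, $$\lim_{t\to\infty}\big\|\chi_D(x)\big(f(x+t\xi,\xi,t)-f_\infty(x,\xi,0)\big)\big\|_O=0.$$ (2) Conversely, for any solution $f_\infty\in S(\tfrac12N)$ of the linear transport equation there exists a family of scattering solutions $u_z\in S(N)$, $z\in[0,\infty)$, of the Boltzmann equation, scattering respectively to unique solutions $f_\infty^z\in S(N)$ of the linear transport equation, i.e. for every compact $D\subset\mathbb{R}^n$, $$\lim_{t\to\infty}\big\|\chi_D(x)\big(u_z(x+t\xi,\xi,t)-f_\infty^z(x,\xi,0)\big)\big\|_O=0,$$ and such that $f_\infty^z$ converges to $f_\infty$ in the sense that for every compact $D\subset\mathbb{R}^n$, $$\lim_{z\to\infty}\big\|\chi_D(x-t\xi)\big(f_\infty(x,\xi,t)-f_\infty^z(x,\xi,t)\big)\big\|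_S=0.$$
   Context: Here $x,\xi\in\mathbb{R}^n$, $t\in[0,\infty)$, $\chi_D$ is the indicator function of $D$, and the linear transport equation is $\partial_t g+\xi\cdot\nabla_x g=0$, i.e. $g(x+t\xi,\xi,t)=g(x,\xi,0)$. The Boltzmann equation is equivalently understood along characteristics: $f(x+t\xi,\xi,t)=f_0(x,\xi)+\int_0^tQ(f,f)(x+s\xi,\xi,s)\,ds$. Collision operator (hard spheres): for $\mathbf n\in S^{n-1}$ put $\xi'=\xi-(\mathbf n\cdot(\xi-\xi_* ))\mathbf n$, $\xi'_*=\xi_*+(\mathbf n\cdot(\xi-\xi_* ))\mathbf n$, and $f=f(x,\xi,t)$, $f_*=f(x,\xi_*,t)$, $f'=f(x,\xi',t)$, $f'_*=f(x,\xi'_*,t)$ (similarly for $g$). Then $$Q^+(f,g)=\tfrac12\int_{\mathbb{R}^n}\int_{S^{n-1}}(f'g'_*+g'f'_* )\,|\mathbf n\cdot(\xi'-\xi'_* )|\,d\mathbf n\,d\xi_*,$$ $$Q^-(f,g)=\tfrac12\int_{\mathbb{R}^n}\int_{S^{n-1}}(f_*g+g_*f)\,|\mathbf n\cdot(\xi-\xi_* )|\,d\mathbf n\,d\xi_*,$$ and $Q(f,g)=Q^+(f,g)-Q^-(f,g)$. Scattering frame: a positive solution $\lambda(x,\xi,t)$ of the linear transport equation such that $$\sup_{x,\xi}\frac{1}{\lambda(x,\xi,0)}\int_0^\infty Q^+(\lambda,\lambda)(x+t\xi,\xi,t)\,dt+\sup_{x,\xi}\frac{1}{\lambda(x,\xi,0)}\int_0^\infty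 Q^-(\lambda,\lambda)(x+t\xi,\xi,t)\,dt<\infty$$ and, for every bounded $D\subset\mathbb{R}^n$, $$\lim_{z\to\infty}\Big(\sup_{x,\xi}\frac{\chi_D(x)}{\lambda(x,\xi,0)}\int_z^\infty Q^+(\lambda,\lambda)(x+t\xi,\xi,t)\,dt+\sup_{x,\xi}\frac{\chi_D(x)}{\lambda(x,\xi,0)}\int_z^\infty Q^-(\lambda,\lambda)(x+t\xi,\xi,t)\,dt\Big)=0.$$ Isotropic radius: $\alpha$ is defined by $$0<\frac1{2\alpha}=\sup_{x,\xi}\frac{1}{\lambda(x,\xi,0)}\int_0^\infty Q^+(\lambda,\lambda)(x+t\xi,\xi,t)\,dt+\sup_{x,\xi}\frac{1}{\lambda(x,\xi,0)}\int_0^\infty Q^-(\lambda,\lambda)(x+t\xi,\xi,t)\,dt<\infty.$$ Norms associated to $\lambda$: $\|f(x,\xi,t)\|_O=\sup_{x,\xi}\frac{|f(x,\xi,t)|}{\lambda(x,\xi,0)}$ (at fixed $t$), $\|f\|_S=\sup_{x,\xi,t}\frac{|f(x,\xi,t)|}{\lambda(x,\xi,t)}=\sup_t\|f(x+t\xi,\xi,t)\|_O$; $f\in S(C)$ if and only if $\|f\|_S\le C$. Scattering solution: a solution $f$ of the Boltzmann equation with $\|f(x,\xi,0)\|_O+\big\|\int_0^\infty|Q(f,f)(x+t\xi,\xi,t)|\,dt\big\|_O<\infty$ and, for every bounded $D\subset\mathbb{R}^n$, $\lim_{z\to\infty}\big\|\chi_D(x)\int_z^\infty|Q(f,f)(x+t\xi,\xi,t)|\,dt\big\|_O=0$.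 Finite mass, energy and momentum of $f_0$ means that the integrals over $\mathbb{R}^n\times\mathbb{R}^n$ of $f_0$, $f_0|\xi|^2$ and $f_0\xi$ are convergent. *)

(* Defs.v *)
From HB Require Import structures.
From mathcomp Require Import all_boot all_order all_algebra.
From mathcomp Require Import all_classical all_reals all_analysis.
From mathcomp Require Import measurable_realfun.

Set Implicit Arguments.
Unset Strict Implicit.
Unset Printing Implicit Defensive.

Import Order.TTheory GRing.Theory Num.Theory.
Import numFieldNormedType.Exports.

Local Open Scope classical_set_scope.
Local Open Scope ring_scope.

(* The sigma-algebra on row vectors is generated by the coordinates, as for
   n.-tuple T; on 'rV[R]_n it is the Borel sigma-algebra of R^n. *)
Section measurable_row_vector.
Context {d} {T : sigmaRingType d}.
Variable n : nat.

Let coors : 'I_n -> 'rV[T]_n -> T := fun i v => v ord0 i.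

Let rv_set0 : g_sigma_preimage coors set0.
Proof. exact: sigma_algebra0. Qed.

Let rv_setC A : g_sigma_preimage coors A -> g_sigma_preimage coors (~` A).
Proof. exact: sigma_algebraC. Qed.

Let rv_bigcup (F : _^nat) : (forall i, g_sigma_preimage coors (F i)) ->
  g_sigma_preimage coors (\bigcup_i (F i)).
Proof. exact: sigma_algebra_bigcup. Qed.

HB.instance Definition _ := @isMeasurable.Build (measure_tuple_display d)
  'rV[T]_n (g_sigma_preimage coors) rv_set0 rv_setC rv_bigcup.

Lemma measurable_rv_coord (i : 'I_n) :
  measurable_fun [set: 'rV[T]_n] (fun v => v ord0 i).
Proof.
move=> _ Y mY; rewrite setTI; apply: sub_sigma_algebra => /=.
rewrite -bigcup_seq/=; exists i => /=; first by rewrite mem_index_enum.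
by exists Y => //; rewrite setTI.
Qed.

End measurable_row_vector.

Lemma measurable_fun_rvP d1 d2 (T1 : measurableType d1) (T2 : measurableType d2)
    n (f : T1 -> 'rV[T2]_n) :
  measurable_fun [set: T1] f <->
  forall i, measurable_fun [set: T1] (fun x => f x ord0 i).
Proof.
split=> [mf i|mf].
  by apply: (measurableT_comp (measurable_rv_coord i) mf).
pose G := \big[setU/set0]_(i < n)
  preimage_set_system [set: 'rV[T2]_n] (fun v => v ord0 i) measurable.
apply: (measurability G) => //.
rewrite /G => _ [A + <-]; rewrite -bigcup_seq => -[i _ [B mB <-]].
by have := mf i measurableT B mB; rewrite !setTI.
Qed.

Section euclidean.
Context {R : realType}.
Variable n : nat.
Implicit Types u v : 'rV[R]_n.

Definition dotv u v : R := \sum_(i < n) u ord0 i * v ord0 i.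

(* The norm `|u| of the library on 'rV[R]_n is the maximum norm. *)
Definition enorm u : R := Num.sqrt (dotv u u).

Definition sphere : set 'rV[R]_n := [set u | enorm u = 1].

Definition punctured_ball : set 'rV[R]_n := [set u | 0 < enorm u <= 1].

Definition normalize u : 'rV[R]_n := (enorm u)^-1 *: u.

Lemma measurable_enorm : measurable_fun [set: 'rV[R]_n] enorm.
Proof.
apply: (@measurableT_comp _ _ _ _ _ _ (@Num.sqrt R)).
  by apply: continuous_measurable_fun; exact: sqrt_continuous.
apply: measurable_sum => i.
by apply: measurable_funM; exact: measurable_rv_coord.
Qed.

Lemma measurable_punctured_ball : measurable punctured_ball.
Proof.
rewrite (_ : punctured_ball = [set: 'rV[R]_n] `&` enorm @^-1` `]0, 1]).
  exact: measurable_enorm.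
by rewrite setTI; apply/seteqP; split => u /=; rewrite in_itv.
Qed.

Lemma measurable_normalize : measurable_fun [set: 'rV[R]_n] normalize.
Proof.
apply/measurable_fun_rvP => i.
under eq_fun do rewrite mxE.
apply: measurable_funM; last exact: measurable_rv_coord.
apply: (@measurableT_comp _ _ _ _ _ _ (@GRing.inv R)); last first.
  exact: measurable_enorm.
rewrite -(setUv [set 0 : R]) measurable_funU//; last exact: measurableC.
split; first exact: measurable_fun_set1.
apply: open_continuous_measurable_fun.
  by apply: closed_openC; exact: accessible_closed_set1 (hausdorff_accessible (@Rhausdorff R)) _.
move=> x /set_mem /= /eqP x0.
exact: inv_continuous.
Qed.

End euclidean.
Arguments sphere {R} n u : rename.
Arguments punctured_ball {R} n u : rename.

Section lebesgue_row_vector.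
Context {R : realType}.

Definition cons_rv n (p : R * 'rV[R]_n) : 'rV[R]_n.+1 :=
  \row_(i < n.+1) (if unlift ord0 i is Some j then p.2 ord0 j else p.1).

Definition behead_rv n (v : 'rV[R]_n.+1) : R * 'rV[R]_n :=
  (v ord0 ord0, \row_(i < n) v ord0 (lift ord0 i)).

Lemma cons_rvK n : cancel (@cons_rv n) (@behead_rv n).
Proof.
move=> [a v]; rewrite /behead_rv mxE unlift_none; congr (_, _).
by apply/rowP => i; rewrite !mxE liftK.
Qed.

Lemma measurable_cons_rv n : measurable_fun setT (@cons_rv n).
Proof.
apply/measurable_fun_rvP => i; under eq_fun do rewrite mxE.
case: unliftP => [j _|_]; last exact: measurable_fst.
exact: (measurableT_comp (measurable_rv_coord j) measurable_snd).
Qed.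

Lemma measurable_behead_rv n : measurable_fun setT (@behead_rv n).
Proof.
apply/measurable_fun_pairP; split; first exact: measurable_rv_coord.
apply/measurable_fun_rvP => i /=; under eq_fun do rewrite mxE.
exact: measurable_rv_coord.
Qed.

Section cons.
Variables (n : nat) (mu : {sigma_finite_measure set 'rV[R]_n -> \bar R}).

Definition lebesgue_cons : set 'rV[R]_n.+1 -> \bar R :=
  pushforward (lebesgue_measure \x mu)%E (@cons_rv n).

Let nu := measure_function_pushforward__canonical__measure_function_Measure
  (lebesgue_measure \x mu)%E (@measurable_cons_rv n).

Let lebesgue_cons0 : lebesgue_cons set0 = 0%E.
Proof. exact: (measure0 nu). Qed.

Let lebesgue_cons_ge0 A : (0 <= lebesgue_cons A)%E.
Proof. exact: (measure_ge0 nu). Qed.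

Let lebesgue_cons_sigma_additive : semi_sigma_additive lebesgue_cons.
Proof. exact: (@measure_semi_sigma_additive _ _ _ nu). Qed.

HB.instance Definition _ := isMeasure.Build _ _ _ lebesgue_cons
  lebesgue_cons0 lebesgue_cons_ge0 lebesgue_cons_sigma_additive.

Let lebesgue_cons_sigma_finite : sigma_finite setT lebesgue_cons.
Proof.
have /sigma_finiteP[F [TF ndF Foo]] := sigma_finiteT (@lebesgue_measure R).
have /sigma_finiteP[G [TG ndG Goo]] := sigma_finiteT mu.
exists (fun k => @behead_rv n @^-1` (F k `*` G k)).
  rewrite -preimage_bigcup (_ : \bigcup_k _ = setT) ?preimage_setT//.
  apply/seteqP; split=> // -[x y] _.
  have [i _ Fix] : (\bigcup_i F i) x by rewrite -TF.
  have [j _ Gjy] : (\bigcup_j G j) y by rewrite -TG.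
  exists (maxn i j) => //; split.
  - by move: x Fix; exact/subsetPset/ndF/leq_maxl.
  - by move: y Gjy; exact/subsetPset/ndG/leq_maxr.
move=> k; have [mF Fk] := Foo k; have [mG Gk] := Goo k; split.
  rewrite -[X in measurable X]setTI.
  by apply: measurable_behead_rv => //; exact: measurableX.
rewrite /lebesgue_cons /pushforward (_ : cons_rv (n:=n) @^-1` _ = F k `*` G k).
  by rewrite product_measure1E// lte_mul_pinfty// ge0_fin_numE.
by rewrite -comp_preimage (_ : _ \o _ = id)//; apply/funext/cons_rvK.
Qed.

HB.instance Definition _ := Measure_isSigmaFinite.Build _ _ _ lebesgue_cons
  lebesgue_cons_sigma_finite.

End cons.

(* Lebesgue measure on R^n as the n-fold product of Lebesgue measure on R. *)
Fixpoint lebesgue_rv n : {sigma_finite_measure set 'rV[R]_n -> \bar R} :=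
  if n is m.+1 then lebesgue_cons (lebesgue_rv m) else \d_(0 : 'rV[R]_0).

End lebesgue_row_vector.

Section sphere_measure.
Context {R : realType}.
Variable n : nat.

(* Surface measure on S^(n-1), as a measure on R^n carried by the sphere: n times
   the Lebesgue measure of the cone { r u | u in A, 0 < r <= 1 } over A, so that
   dx = r^(n-1) dr du in polar coordinates. For n = 1 it is the counting measure
   on {-1, 1}. *)
Definition sphere_measure : set 'rV[R]_n -> \bar R :=
  pushforward
    (mscale n%:R%:nng
       (mrestr (lebesgue_rv n) (@measurable_punctured_ball R n)))
    (@normalize R n).

Let nu := measure_function_pushforward__canonical__measure_function_Measure
  (mscale n%:R%:nng (mrestr (lebesgue_rv n) (@measurable_punctured_ball R n)))
  (@measurable_normalize R n).

Let sphere_measure0 : sphere_measure set0 = 0%E.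
Proof. exact: (measure0 nu). Qed.

Let sphere_measure_ge0 A : (0 <= sphere_measure A)%E.
Proof. exact: (measure_ge0 nu). Qed.

Let sphere_measure_sigma_additive : semi_sigma_additive sphere_measure.
Proof. exact: (@measure_semi_sigma_additive _ _ _ nu). Qed.

HB.instance Definition _ := isMeasure.Build _ _ _ sphere_measure
  sphere_measure0 sphere_measure_ge0 sphere_measure_sigma_additive.

End sphere_measure.
Arguments sphere_measure {R} n A : rename.

(* A function f(x, xi, t). Only its values at t >= 0 are meaningful: every notion
   below, equality included, is restricted to t >= 0. *)
Definition evolution (R : realType) (n : nat) := 'rV[R]_n -> 'rV[R]_n -> R -> R.

Section boltzmann.
Context {R : realType} {n : nat}.

Implicit Types (f g lam finf : evolution R n) (D : set 'rV[R]_n).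

Definition eq_evolution f g : Prop :=
  forall x xi t, 0 <= t -> f x xi t = g x xi t.

Definition unique_evolution (P : evolution R n -> Prop) f : Prop :=
  P f /\ forall g, P g -> eq_evolution f g.

Definition measurable_evolution f : Prop :=
  measurable_fun [set p : 'rV[R]_n * 'rV[R]_n * R | 0 <= p.2]
    (fun p => f p.1.1 p.1.2 p.2).

Definition transport_solution g : Prop :=
  measurable_evolution g /\
  forall x xi t, 0 <= t -> g (x + t *: xi) xi t = g x xi 0.

Definition post1 (xi xis w : 'rV[R]_n) : 'rV[R]_n :=
  xi - dotv w (xi - xis) *: w.

Definition post2 (xi xis w : 'rV[R]_n) : 'rV[R]_n :=
  xis + dotv w (xi - xis) *: w.

Definition Qgain f g (x xi : 'rV[R]_n) (t : R) : \bar R :=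
  ((2^-1)%:E * \int[lebesgue_rv n]_xis \int[sphere_measure n]_(w in sphere n)
    ((f x (post1 xi xis w) t * g x (post2 xi xis w) t
      + g x (post1 xi xis w) t * f x (post2 xi xis w) t)
     * `|dotv w (post1 xi xis w - post2 xi xis w)|)%:E)%E.

Definition Qloss f g (x xi : 'rV[R]_n) (t : R) : \bar R :=
  ((2^-1)%:E * \int[lebesgue_rv n]_xis \int[sphere_measure n]_(w in sphere n)
    ((f x xis t * g x xi t + g x xis t * f x xi t)
     * `|dotv w (xi - xis)|)%:E)%E.

(* Where both terms are infinite the value is -oo, by the convention of \bar R
   for +oo - +oo; integrability along characteristics then forces such times to
   be negligible. *)
Definition Q f g (x xi : 'rV[R]_n) (t : R) : \bar R :=
  (Qgain f g x xi t - Qloss f g x xi t)%E.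

Definition along (h : 'rV[R]_n -> 'rV[R]_n -> R -> \bar R)
    (x xi : 'rV[R]_n) (t : R) : \bar R :=
  h (x + t *: xi) xi t.

Definition boltzmann_solution f : Prop :=
  measurable_evolution f /\
  forall x xi t, 0 <= t ->
    lebesgue_measure.-integrable `[0, t] (along (Q f f) x xi) /\
    (f (x + t *: xi) xi t)%:E =
      ((f x xi 0)%:E + \int[lebesgue_measure]_(s in `[0%R, t])
                          along (Q f f) x xi s)%E.

Definition tail_sup
    (q : evolution R n -> evolution R n -> 'rV[R]_n -> 'rV[R]_n -> R -> \bar R)
    lam D (z : R) : \bar R :=
  ereal_sup [set ((\1_D p.1 / lam p.1 p.2 0)%:E *
      \int[lebesgue_measure]_(t in `[z, +oo[) along (q lam lam) p.1 p.2 t)%E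
    | p in [set: 'rV[R]_n * 'rV[R]_n]].

Definition collision_sup lam : \bar R :=
  (tail_sup Qgain lam setT 0 + tail_sup Qloss lam setT 0)%E.

Definition scattering_frame lam : Prop :=
  [/\ transport_solution lam,
      forall x xi t, 0 <= t -> 0 < lam x xi t,
      (collision_sup lam < +oo)%E &
      forall D, bounded_set D ->
        (tail_sup Qgain lam D z + tail_sup Qloss lam D z)%E
          @[z --> +oo%R] --> 0%E].

Definition isotropic_radius lam (alpha : R) : Prop :=
  0 < (2 * alpha)^-1 /\ ((2 * alpha)^-1)%:E = collision_sup lam.

Definition normO lam (h : 'rV[R]_n -> 'rV[R]_n -> \bar R) : \bar R :=
  ereal_sup [set (`|h p.1 p.2| * ((lam p.1 p.2 0)^-1)%:E)%E
    | p in [set: 'rV[R]_n * 'rV[R]_n]].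

Definition normS lam f : \bar R :=
  ereal_sup [set (`|f p.1.1 p.1.2 p.2| / lam p.1.1 p.1.2 p.2)%:E
    | p in [set p : 'rV[R]_n * 'rV[R]_n * R | 0 <= p.2]].

Definition inS lam (C : R) f : Prop := (normS lam f <= C%:E)%E.

Definition abs_collision_tail f (z : R) (x xi : 'rV[R]_n) : \bar R :=
  (\int[lebesgue_measure]_(t in `[z, +oo[) `|along (Q f f) x xi t|)%E.

Definition scattering_solution lam f : Prop :=
  [/\ boltzmann_solution f,
      (normO lam (fun x xi => (f x xi 0)%:E)
        + normO lam (abs_collision_tail f 0) < +oo)%E &
      forall D, bounded_set D ->
        normO lam (fun x xi => (\1_D x)%:E * abs_collision_tail f z x xi)%E
          @[z --> +oo%R] --> 0%E].

Definition scatters_to lam f finf : Prop :=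
  forall D, compact D ->
    normO lam (fun x xi =>
        (\1_D x * (f (x + t *: xi) xi t - finf x xi 0))%:E)
      @[t --> +oo%R] --> 0%E.

Definition finite_mass_energy_momentum (f0 : 'rV[R]_n -> 'rV[R]_n -> R) : Prop :=
  let mu := (lebesgue_rv n \x lebesgue_rv n)%E in
  [/\ mu.-integrable setT (fun p => (f0 p.1 p.2)%:E),
      mu.-integrable setT (fun p => (f0 p.1 p.2 * enorm p.2 ^+ 2)%:E) &
      forall i : 'I_n,
        mu.-integrable setT (fun p => (f0 p.1 p.2 * p.2 ord0 i)%:E)].

End boltzmann.

(* Main.v *)
(* Along characteristics the Boltzmann equation reads
   f(x + t xi, xi, t) = g0(x, xi) + int_z^t Q(f, f)(x + s xi, xi, s) ds
   with z = 0 and g0 = f0 for (1), and with g0 = finf(., ., 0) for u_z in (2).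
   If |f|, |g| <= N lam and |f - g| <= e lam, bilinearity gives
   |Q(f, f)| <= N^2 L and |Q(f, f) - Q(g, g)| <= 2 N e L, where
   L = Q^+(lam, lam) + Q^-(lam, lam) has integral at most lam / (2 alpha) along
   every characteristic.  Hence the right-hand side maps S(N) to itself and is a
   contraction of ratio N / alpha < 1 for the scattering norm.  Its fixed point
   differs from its outgoing profile g0 + int_z^oo Q(f, f) by at most
   N^2 int_t^oo L, and that profile differs from g0 by at most N^2 int_z^oo L;
   both bounds vanish locally in x by the tail condition on the frame. *)

From HB Require Import structures.
Require Import Defs.
From mathcomp Require Import all_boot all_order all_algebra.
From mathcomp Require Import all_classical all_reals all_analysis.
From mathcomp Require Import measurable_realfun ring lra.

Set Implicit Arguments.
Unset Strict Implicit.
Unset Printing Implicit Defensive.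

Import Order.TTheory GRing.Theory Num.Theory.
Import numFieldNormedType.Exports.

Local Open Scope classical_set_scope.
Local Open Scope ring_scope.

(** The obstacle is that [Q] takes values in the extended reals, where a difference of infinities
    has a conventional value that obeys no algebra. Since L is integrable along every
    characteristic, it is finite at almost every time; at such a time the gain and loss of the frame
    are finite, and so are their sphere integrals for almost every [xis]. Differences are therefore
    compared only on these sets, once inside the collision integral and once more in time, which is
    why the comparison of integrals carries a second, integrable majorant besides the sharp one.
    Another point is that only t >= 0 is meaningful, while measurability is handled on the whole
    product: given functions are read at max(t, 0), which changes nothing at meaningful times. *)

(* The third bound is only asked where h' is finite: elsewhere k1 - k2 may be an
   undefined difference of infinities, but that set is negligible. *)
Lemma integral_sub_le d (T : measurableType d) (R : realType)
    (mu : {measure set T -> \bar R}) (D : set T) (k1 k2 h h' : T -> \bar R) :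
  measurable D ->
  measurable_fun D k1 -> measurable_fun D k2 ->
  measurable_fun D h -> measurable_fun D h' ->
  (forall x, D x -> (0 <= h x)%E) ->
  (forall x, D x -> (`|k1 x| <= h' x)%E) ->
  (forall x, D x -> (`|k2 x| <= h' x)%E) ->
  (forall x, D x -> (h' x < +oo)%E -> (`|k1 x - k2 x| <= h x)%E) ->
  (\int[mu]_(x in D) h' x < +oo)%E ->
  (`|\int[mu]_(x in D) k1 x - \int[mu]_(x in D) k2 x|
    <= \int[mu]_(x in D) h x)%E.
Proof.
move=> mD mk1 mk2 mh mh' h0 k1h k2h kh h'oo.
have h'0 x : D x -> (0 <= h' x)%E by move=> Dx; exact: le_trans (k1h x Dx).
have ih' : mu.-integrable D h'.
  apply/integrableP; split => //.
  by under eq_integral => x /set_mem Dx do rewrite gee0_abs ?h'0//.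
have ik1 : mu.-integrable D k1.
  by apply: (le_integrable mD mk1 _ ih') => x Dx;
    rewrite (gee0_abs (h'0 x Dx)) k1h.
have ik2 : mu.-integrable D k2.
  by apply: (le_integrable mD mk2 _ ih') => x Dx;
    rewrite (gee0_abs (h'0 x Dx)) k2h.
rewrite -integralB//; apply: le_trans (le_abse_integral _ mD _) _.
  exact: emeasurable_funB.
apply: ae_ge0_le_integral => //.
  by apply: measurableT_comp => //; exact: emeasurable_funB.
have := integrable_ae mD ih'; apply: filterS => x fx Dx.
by apply: kh => //; rewrite -ge0_fin_numE ?fx ?h'0.
Qed.

(** The integral is the difference of those of the positive and negative parts, and Tonelli applies
    to each part, so neither a sign nor integrability is asked of F. Restricting the integrand to D
    beforehand reduces to integrals over the whole space. *)
Lemma measurable_integral_section d1 d2 (T1 : measurableType d1)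
    (T2 : measurableType d2) (R : realType)
    (m2 : {sigma_finite_measure set T2 -> \bar R}) (D : set T2)
    (F : T1 * T2 -> \bar R) :
  measurable D -> measurable_fun [set: T1 * T2] F ->
  measurable_fun [set: T1] (fun x => \int[m2]_(y in D) F (x, y))%E.
Proof.
move=> mD mF.
have -> : (fun x => \int[m2]_(y in D) F (x, y))%E =
    (fun x => \int[m2]_y (F \_ (setT `*` D)) (x, y))%E.
  apply/funext => x; rewrite integral_mkcond; apply: eq_integral => y _.
  rewrite !patchE; congr (if _ then _ else _).
  by apply/idP/idP => /set_mem H; apply/mem_set => //; case: H.
have mG : measurable_fun setT (F \_ (setT `*` D)).
  apply: (measurable_restrictT F _).1; first exact: measurableX.
  exact: measurable_funTS.
set G := F \_ (setT `*` D) in mG *.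
have -> : (fun x => \int[m2]_y G (x, y))%E =
    (fun x => fubini_F m2 G^\+ x - fubini_F m2 G^\- x)%E.
  apply/funext => x; rewrite integralE /fubini_F; congr (_ - _)%E;
    apply: eq_integral => y _; by rewrite ?funeposE ?funenegE.
apply: emeasurable_funB; apply: measurable_fun_fubini_tonelli_F => //.
  exact: measurable_funepos.
exact: measurable_funeneg.
Qed.

(** * Limits at a geometric rate *)

Section real_sequences.
Context {R : realType}.

Lemma geometric_cvg0 (M q : R) : 0 <= q < 1 ->
  (M * q ^+ k) @[k --> \oo] --> (0 : R).
Proof.
by move=> /andP[q0 q1]; apply: (@cvg_geometric _ M q); rewrite ger0_norm.
Qed.

Lemma geometric_le0 (M q a : R) : 0 <= q < 1 ->
  (forall k : nat, a <= M * q ^+ k) -> a <= 0.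
Proof.
move=> q01 H; have := geometric_cvg0 M q01 => Mq.
rewrite -(cvg_lim (@Rhausdorff R) Mq); apply: limr_ge; first by apply: cvgP Mq.
by apply: nearW.
Qed.

(** The error e k is the tail sum of M q^j over j >= k, so the intervals [a k - e k, a k + e k] are
    nested and the supremum of their left ends lies in all of them. The rate comes together with the
    limit. *)
Lemma geometric_step_limit (a : nat -> R) (M q : R) : 0 <= q < 1 ->
  (forall k, `|a k.+1 - a k| <= M * q ^+ k) ->
  exists l, forall k, `|l - a k| <= M / (1 - q) * q ^+ k.
Proof.
move=> q01 H; case/andP: (q01) => q0 q1.
set e := fun k => M / (1 - q) * q ^+ k.
have M0 : 0 <= M by have := H 0%N; rewrite expr0 mulr1; exact: le_trans.
have e0 k : 0 <= e k by rewrite mulr_ge0 ?exprn_ge0// divr_ge0// subr_ge0 ltW.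
have eS k : e k - e k.+1 = M * q ^+ k.
  rewrite /e exprS; field; lra.
have lo j k : (j <= k)%N -> a j - e j <= a k - e k.
  move=> /subnKC <-; elim: (k - j)%N => [|i IH]; rewrite ?addn0// addnS.
  apply: le_trans IH _; have := H (j + i)%N; have := eS (j + i)%N.
  by rewrite ler_norml => <- /andP[]; lra.
have hi j k : (j <= k)%N -> a k + e k <= a j + e j.
  move=> /subnKC <-; elim: (k - j)%N => [|i IH]; rewrite ?addn0// addnS.
  apply: le_trans _ IH; have := H (j + i)%N; have := eS (j + i)%N.
  by rewrite ler_norml => <- /andP[]; lra.
have lh j k : a j - e j <= a k + e k.
  have := lo j _ (leq_maxl j k); have := hi k _ (leq_maxr j k).
  by have := e0 (maxn j k); lra.
exists (sup (range (fun k => a k - e k))) => k.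
have hs : has_sup (range (fun k => a k - e k)).
  by split; [exists (a 0%N - e 0%N), 0%N | exists (a 0%N + e 0%N) =>
    _ [j _ <-]].
have l1 : a k - e k <= sup (range (fun k => a k - e k)).
  by apply: ub_le_sup; [case: hs | exists k].
have l2 : sup (range (fun k => a k - e k)) <= a k + e k.
  by apply: ge_sup; [case: hs | move=> _ [j _ <-]].
by rewrite -/(e k) ler_norml; lra.
Qed.

End real_sequences.

(** * Measurability of the collision operator *)

Section finite_sphere_measure.
Context {R : realType}.

Let box n : set 'rV[R]_n := [set v | forall i, `|v ord0 i| <= 1].

Let measurable_box n : measurable (@box n).
Proof.
rewrite (_ : @box n = \bigcap_(i in setT) ((fun v => v ord0 i) @^-1` `[-1, 1])).
  apply: fin_bigcap_measurable => // i _.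
  by rewrite -[X in measurable X]setTI; exact: measurable_rv_coord.
apply/seteqP; split=> [v vb i _|v vb i].
  by rewrite /= in_itv/= -ler_norml; exact: vb.
by have := vb i I; rewrite /= in_itv/= -ler_norml.
Qed.

Let lebesgue_box n : (lebesgue_rv n (@box n) < +oo)%E.
Proof.
elim: n => [|n IH] /=; first by rewrite diracE ltry.
rewrite /lebesgue_cons /pushforward.
rewrite (_ : _ @^-1` _ = `[-1, 1] `*` @box n).
  rewrite product_measure1E; [|exact: measurable_itv|exact: measurable_box].
  rewrite /= lebesgue_measure_itv/= lte_fin ifT; last by lra.
  by rewrite -EFinD lte_mul_pinfty// lee_fin; lra.
apply/seteqP; split=> [[a v] H|[a v] [/= a1 H] i].
  split=> /= [|i]; first by have := H ord0;
    rewrite mxE unlift_none /= in_itv/= -ler_norml.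
  by have := H (lift ord0 i); rewrite mxE liftK.
rewrite mxE; case: unliftP => [j _|_]; first exact: H.
by move: a1; rewrite in_itv/= -ler_norml.
Qed.

(** The truncated cone over any set lies in the unit ball, hence in the cube [box n], whose volume
    is finite by induction on n. Finiteness makes Tonelli available for the integral over the
    sphere. *)
Let sphere_measure_fin n : fin_num_fun (@sphere_measure R n).
Proof.
move=> A mA; rewrite ge0_fin_numE//;
  apply: (@le_lt_trans _ _ (n%:R%:E * lebesgue_rv n (@box n))%E).
  rewrite /sphere_measure /pushforward /mscale /mrestr /=.
  rewrite lee_wpmul2l ?lee_fin//; apply: le_measure; rewrite ?inE.
  - apply: measurableI; last exact: measurable_punctured_ball.
    by rewrite -[X in measurable X]setTI; exact: measurable_normalize.
  - exact: measurable_box.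
  move=> v [_]; rewrite /punctured_ball /= => /andP[_ v1] i.
  rewrite -sqrtr_sqr; apply: le_trans v1; rewrite /enorm ler_sqrt.
    rewrite /dotv (bigD1 i)//= expr2 lerDl sumr_ge0// => j _.
    by rewrite -expr2 sqr_ge0.
  by rewrite sumr_ge0// => j _; rewrite -expr2 sqr_ge0.
by rewrite lte_mul_pinfty ?lee_fin.
Qed.

HB.instance Definition _ n :=
  @Measure_isFinite.Build _ _ R (@sphere_measure R n) (@sphere_measure_fin n).

Lemma measurable_sphere n : measurable (@sphere R n).
Proof.
rewrite (_ : sphere n = [set: 'rV[R]_n] `&` @enorm R n @^-1` [set 1]).
  exact: measurable_enorm.
by rewrite setTI.
Qed.

End finite_sphere_measure.

Section measurable_vectors.
Context {R : realType} {n : nat} {d} {T : measurableType d}.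
Implicit Types (a b : T -> 'rV[R]_n) (c : T -> R).

Lemma measurable_rvD a b : measurable_fun setT a -> measurable_fun setT b ->
  measurable_fun setT (fun x => a x + b x).
Proof.
move=> /measurable_fun_rvP ma /measurable_fun_rvP mb.
by apply/measurable_fun_rvP => i; under eq_fun do rewrite mxE;
  exact: measurable_funD.
Qed.

Lemma measurable_rvZ c a : measurable_fun setT c -> measurable_fun setT a ->
  measurable_fun setT (fun x => c x *: a x).
Proof.
move=> mc /measurable_fun_rvP ma.
by apply/measurable_fun_rvP => i; under eq_fun do rewrite mxE;
  exact: measurable_funM.
Qed.

Lemma measurable_rvN a : measurable_fun setT a ->
  measurable_fun setT (fun x => - a x).
Proof.
move=> ma; under eq_fun do rewrite -scaleN1r.
by apply: measurable_rvZ => //; exact: measurable_cst.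
Qed.

Lemma measurable_rvB a b : measurable_fun setT a -> measurable_fun setT b ->
  measurable_fun setT (fun x => a x - b x).
Proof. by move=> ma mb; apply: measurable_rvD => //; exact: measurable_rvN. Qed.

Lemma measurable_dotv a b : measurable_fun setT a -> measurable_fun setT b ->
  measurable_fun setT (fun x => dotv (a x) (b x)).
Proof.
move=> /measurable_fun_rvP ma /measurable_fun_rvP mb.
by apply: measurable_sum => i; exact: measurable_funM.
Qed.

End measurable_vectors.

Section collision_measurability.
Context {R : realType} {n : nat}.
Implicit Types f g : evolution R n.

(** Without the restriction to t >= 0 of [measurable_evolution], the property composes with
    arbitrary measurable maps, with no condition on their range. *)
Definition total_measurable f :=
  measurable_fun [set: 'rV[R]_n * 'rV[R]_n * R] (fun p => f p.1.1 p.1.2 p.2).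

Lemma measurable_evolution_comp d (T : measurableType d) f
    (a b : T -> 'rV[R]_n) (c : T -> R) : total_measurable f ->
  measurable_fun setT a -> measurable_fun setT b -> measurable_fun setT c ->
  measurable_fun setT (fun x => f (a x) (b x) (c x)).
Proof.
move=> mf ma mb mc.
apply: (measurableT_comp mf (g := fun x => (a x, b x, c x))).
by apply: measurable_fun_pair => //; exact: measurable_fun_pair.
Qed.

(** The two equal summands are kept so that [Qgain f f] is the integral of this kernel by
    conversion. *)
Definition gain_kernel f x xi t xis w : R :=
  (f x (post1 xi xis w) t * f x (post2 xi xis w) t
      + f x (post1 xi xis w) t * f x (post2 xi xis w) t)
     * `|dotv w (post1 xi xis w - post2 xi xis w)|.

Definition loss_kernel f x xi t xis w : R :=
  (f x xis t * f x xi t + f x xis t * f x xi t) * `|dotv w (xi - xis)|.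

(** Common form of gain and loss: each estimate on the double integral is proved once, for an
    arbitrary kernel. *)
Definition collision_integral (k : 'rV[R]_n -> 'rV[R]_n -> R) : \bar R :=
  ((2^-1)%:E * \int[lebesgue_rv n]_xis
     \int[sphere_measure n]_(w in sphere n) (k xis w)%:E)%E.

Lemma QgainE f x xi t :
  Qgain f f x xi t = collision_integral (gain_kernel f x xi t).
Proof. by []. Qed.

Lemma QlossE f x xi t :
  Qloss f f x xi t = collision_integral (loss_kernel f x xi t).
Proof. by []. Qed.

Lemma measurable_gain_kernel d (T : measurableType d) f
    (x xi xis w : T -> 'rV[R]_n) (t : T -> R) : total_measurable f ->
  measurable_fun setT x -> measurable_fun setT xi -> measurable_fun setT t ->
  measurable_fun setT xis -> measurable_fun setT w ->
  measurable_fun setT (fun p => gain_kernel f (x p) (xi p) (t p) (xis p) (w p)).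
Proof.
move=> mf mx mxi mt mxis mw; rewrite /gain_kernel.
have md : measurable_fun setT (fun p => dotv (w p) (xi p - xis p) *: w p).
  by apply: measurable_rvZ => //; apply: measurable_dotv => //;
    exact: measurable_rvB.
have m1 : measurable_fun setT (fun p => post1 (xi p) (xis p) (w p)).
  exact: measurable_rvB.
have m2 : measurable_fun setT (fun p => post2 (xi p) (xis p) (w p)).
  exact: measurable_rvD.
apply: measurable_funM; last first.
  apply: measurableT_comp => //; apply: measurable_dotv => //;
    exact: measurable_rvB.
by apply: measurable_funD; apply: measurable_funM;
  exact: measurable_evolution_comp.
Qed.

Lemma measurable_loss_kernel d (T : measurableType d) f
    (x xi xis w : T -> 'rV[R]_n) (t : T -> R) : total_measurable f ->
  measurable_fun setT x -> measurable_fun setT xi -> measurable_fun setT t ->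
  measurable_fun setT xis -> measurable_fun setT w ->
  measurable_fun setT (fun p => loss_kernel f (x p) (xi p) (t p) (xis p) (w p)).
Proof.
move=> mf mx mxi mt mxis mw; rewrite /loss_kernel.
apply: measurable_funM; last first.
  apply: measurableT_comp => //; apply: measurable_dotv => //;
    exact: measurable_rvB.
by apply: measurable_funD; apply: measurable_funM;
  exact: measurable_evolution_comp.
Qed.

Lemma measurable_collision_integral d (T : measurableType d)
    (k : T -> 'rV[R]_n -> 'rV[R]_n -> R) :
  measurable_fun setT (fun p : T * 'rV[R]_n * 'rV[R]_n => k p.1.1 p.1.2 p.2) ->
  measurable_fun setT (fun p => collision_integral (k p)).
Proof.
move=> mk; apply: emeasurable_funM; first exact: measurable_cst.
apply: (@measurable_integral_section _ _ _ _ _ (lebesgue_rv n) setT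
  (fun p => \int[sphere_measure n]_(w in sphere n) (k p.1 p.2 w)%:E)%E) => //.
apply: (@measurable_integral_section _ _ _ _ _ (sphere_measure n) (sphere n)
  (fun p : T * 'rV[R]_n * 'rV[R]_n => (k p.1.1 p.1.2 p.2)%:E)).
  exact: measurable_sphere.
exact/measurable_EFinP.
Qed.

Lemma measurable_Qgain d (T : measurableType d) f (x xi : T -> 'rV[R]_n)
    (t : T -> R) : total_measurable f ->
  measurable_fun setT x -> measurable_fun setT xi -> measurable_fun setT t ->
  measurable_fun setT (fun p => Qgain f f (x p) (xi p) (t p)).
Proof.
move=> mf mx mxi mt; under eq_fun do rewrite QgainE.
apply: measurable_collision_integral.
have m11 := measurableT_comp (@measurable_fst _ _ T 'rV[R]_n)
  (@measurable_fst _ _ (T * 'rV[R]_n)%type 'rV[R]_n).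
apply: measurable_gain_kernel => //.
- exact: measurableT_comp mx m11.
- exact: measurableT_comp mxi m11.
- exact: measurableT_comp mt m11.
- exact: measurableT_comp measurable_snd measurable_fst.
Qed.

Lemma measurable_Qloss d (T : measurableType d) f (x xi : T -> 'rV[R]_n)
    (t : T -> R) : total_measurable f ->
  measurable_fun setT x -> measurable_fun setT xi -> measurable_fun setT t ->
  measurable_fun setT (fun p => Qloss f f (x p) (xi p) (t p)).
Proof.
move=> mf mx mxi mt; under eq_fun do rewrite QlossE.
apply: measurable_collision_integral.
have m11 := measurableT_comp (@measurable_fst _ _ T 'rV[R]_n)
  (@measurable_fst _ _ (T * 'rV[R]_n)%type 'rV[R]_n).
apply: measurable_loss_kernel => //.
- exact: measurableT_comp mx m11.
- exact: measurableT_comp mxi m11.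
- exact: measurableT_comp mt m11.
- exact: measurableT_comp measurable_snd measurable_fst.
Qed.

Lemma measurable_Q d (T : measurableType d) f (x xi : T -> 'rV[R]_n)
    (t : T -> R) : total_measurable f ->
  measurable_fun setT x -> measurable_fun setT xi -> measurable_fun setT t ->
  measurable_fun setT (fun p => Q f f (x p) (xi p) (t p)).
Proof.
move=> mf mx mxi mt; apply: emeasurable_funB.
  exact: measurable_Qgain.
exact: measurable_Qloss.
Qed.

End collision_measurability.

(** * Bilinear estimates for the collision operator *)

Section collision_bounds.
Context {R : realType} {n : nat}.
Implicit Types (k h : 'rV[R]_n -> 'rV[R]_n -> R).

Let meas k :=
  measurable_fun [set: 'rV[R]_n * 'rV[R]_n] (fun p => k p.1 p.2).

Let meas_section k x : meas k -> measurable_fun setT (k x).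
Proof.
move=> mk; apply: (measurableT_comp mk (g := fun y => (x, y))).
by apply: measurable_fun_pair; [exact: measurable_cst|exact: measurable_id].
Qed.

Let inner k x : \bar R := (\int[sphere_measure n]_(w in sphere n) (k x w)%:E)%E.

Let meas_inner k : meas k -> measurable_fun setT (inner k).
Proof.
move=> mk; apply: (@measurable_integral_section _ _ _ _ _ (sphere_measure n)
  (sphere n) (fun p : 'rV[R]_n * 'rV[R]_n => (k p.1 p.2)%:E)).
  exact: measurable_sphere.
exact/measurable_EFinP.
Qed.

Let meas_sphere k x : meas k -> measurable_fun (sphere n) (fun w => (k x w)%:E).
Proof.
by move=> mk; apply/measurable_EFinP; apply: measurable_funTS;
  exact: meas_section.
Qed.

Let inner_ge0 k x : (forall y w, 0 <= k y w) -> (0 <= inner k x)%E.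
Proof. by move=> k0; apply: integral_ge0 => w _; rewrite lee_fin. Qed.

Let inner_abs k h x : meas k -> meas h -> (forall y w, `|k y w| <= h y w) ->
  (`|inner k x| <= inner h x)%E.
Proof.
move=> mk mh kh.
apply: le_trans (le_abse_integral _ (@measurable_sphere R n) _) _.
  exact: meas_sphere.
apply: ge0_le_integral => //; first exact: measurable_sphere.
- by apply: measurableT_comp => //; exact: meas_sphere.
- exact: meas_sphere.
- by move=> w _; rewrite lee_fin.
Qed.

Let outer_abs k h : meas k -> meas h -> (forall y w, `|k y w| <= h y w) ->
  (`|\int[lebesgue_rv n]_x inner k x| <= \int[lebesgue_rv n]_x inner h x)%E.
Proof.
move=> mk mh kh.
apply: le_trans (le_abse_integral _ measurableT _) _; first exact: meas_inner.
apply: ge0_le_integral => //.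
- by apply: measurableT_comp => //; exact: meas_inner.
- exact: meas_inner.
- by move=> x _; exact: inner_abs.
Qed.

Lemma collision_integral_ge0 h : (forall y w, 0 <= h y w) ->
  (0 <= collision_integral h)%E.
Proof.
by move=> h0; apply: mule_ge0 => //; apply: integral_ge0 => x _;
  exact: inner_ge0.
Qed.

Lemma collision_integral_scale h (c : R) : meas h -> 0 <= c ->
  (forall y w, 0 <= h y w) ->
  collision_integral (fun y w => c * h y w) = (c%:E * collision_integral h)%E.
Proof.
move=> mh c0 h0; rewrite /collision_integral muleCA; congr (_ * _)%E.
rewrite -ge0_integralZl_EFin//.
- apply: eq_integral => x _; rewrite -ge0_integralZl_EFin//.
  + exact: measurable_sphere.
  + by move=> w _; rewrite lee_fin.
  + exact: meas_sphere.
- by move=> x _; exact: inner_ge0.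
- exact: meas_inner.
Qed.

Lemma collision_integral_abs k h : meas k -> meas h ->
  (forall y w, `|k y w| <= h y w) ->
  (`|collision_integral k| <= collision_integral h)%E.
Proof.
move=> mk mh kh; rewrite /collision_integral abseM /= ger0_norm//.
by rewrite lee_wpmul2l ?lee_fin//; exact: outer_abs.
Qed.

(** Two nested uses of [integral_sub_le]. The finite integral of h' makes the outer integrals
    finite, so the subtraction can pass under them; it then passes under the sphere integral at
    those [xis] where that of h' is finite. *)
Lemma collision_integral_sub k1 k2 h h' : meas k1 -> meas k2 -> meas h ->
  meas h' -> (forall y w, `|k1 y w| <= h' y w) ->
  (forall y w, `|k2 y w| <= h' y w) ->
  (forall y w, `|k1 y w - k2 y w| <= h y w) ->
  (collision_integral h' < +oo)%E ->
  (`|collision_integral k1 - collision_integral k2| <= collision_integral h)%E.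
Proof.
move=> mk1 mk2 mh mh' k1h k2h kh h'oo.
have h'0 y w : 0 <= h' y w by exact: le_trans (k1h y w).
have h0 y w : 0 <= h y w by exact: le_trans (kh y w).
have outeroo : (\int[lebesgue_rv n]_x inner h' x < +oo)%E.
  have : (2%:E * collision_integral h' < +oo)%E by rewrite lte_mul_pinfty//
    lee_fin.
  by rewrite /collision_integral muleA -EFinM divff// mul1e.
have fin k : meas k -> (forall y w, `|k y w| <= h' y w) ->
    (\int[lebesgue_rv n]_x inner k x)%E \is a fin_num.
  by move=> mk kh'; rewrite fin_num_abs; apply: le_lt_trans outeroo;
    exact: outer_abs.
rewrite /collision_integral -muleBr//; last first.
  by apply: fin_num_adde_defr; exact: (fin k1).
rewrite abseM /= ger0_norm// lee_wpmul2l ?lee_fin//.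
apply: (@integral_sub_le _ _ _ _ _ _ _ (inner h) (inner h')) => //;
  try exact: meas_inner.
- by move=> x _; exact: inner_ge0.
- by move=> x _; exact: inner_abs.
- by move=> x _; exact: inner_abs.
move=> x _ h'x.
apply: (@integral_sub_le _ _ _ _ _ _ _ _ (fun w => (h' x w)%:E)) => //;
  try exact: meas_sphere.
- exact: measurable_sphere.
- by move=> w _; rewrite lee_fin.
- by move=> w _; rewrite lee_fin.
- by move=> w _; rewrite lee_fin.
- by move=> w _ _; rewrite lee_fin.
Qed.

End collision_bounds.

(** This regrouping can fail at infinite values. It serves to pair gain with gain and loss with
    loss. *)
Lemma fin_subBB (R : realDomainType) (a b c d : \bar R) :
  a \is a fin_num -> b \is a fin_num -> c \is a fin_num -> d \is a fin_num ->
  ((a - b) - (c - d) = (a - c) - (b - d))%E.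
Proof.
move=> /fineK <- /fineK <- /fineK <- /fineK <-.
by rewrite -!EFinB; congr EFin; ring.
Qed.

Section kernel_bounds.
Context {R : realType} {n : nat}.
Implicit Types f g lam : evolution R n.

Let product_abs (C a b A B d : R) : `|a| <= C * A -> `|b| <= C * B ->
  `|(a * b + a * b) * `|d| | <= C ^+ 2 * ((A * B + A * B) * `|d|).
Proof.
move=> aA bB; rewrite normrM normr_id mulrA ler_wpM2r//.
rewrite -mulr2n normrMn normrM -!mulr2n mulrnAr lerMn2r/=.
by rewrite expr2 mulrACA ler_pM.
Qed.

(** Splitting a b - a' b' as a (b - b') + (a - a') b' gives two terms of size at most C e A B each,
    whence the constant 2 C e. In the application A and B are values of the frame and |d| is the
    hard-sphere factor. *)
Let product_sub (C e a b a' b' A B d : R) : `|a| <= C * A -> `|b'| <= C * B ->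
  `|a - a'| <= e * A -> `|b - b'| <= e * B ->
  `|(a * b + a * b) * `|d| - (a' * b' + a' * b') * `|d| |
    <= (2 * C * e) * ((A * B + A * B) * `|d|).
Proof.
move=> aA bB daA dbB; rewrite -mulrBl normrM normr_id mulrA ler_wpM2r//.
have -> : a * b + a * b - (a' * b' + a' * b') = (a * (b - b') + (a - a') * b')
  *+ 2.
  by rewrite mulr2n; ring.
have -> : 2 * C * e * (A * B + A * B) = (C * A * (e * B) + e * A * (C * B))
  *+ 2.
  by rewrite mulr2n; ring.
rewrite normrMn lerMn2r/=; apply: le_trans (ler_normD _ _) _.
by rewrite !normrM lerD// ler_pM.
Qed.

(** The L of the overview when f is the frame. *)
Definition total_collision f (x xi : 'rV[R]_n) (t : R) : \bar R :=
  (Qgain f f x xi t + Qloss f f x xi t)%E.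

Lemma measurable_total_collision d (T : measurableType d) f
    (x xi : T -> 'rV[R]_n) (t : T -> R) : total_measurable f ->
  measurable_fun setT x -> measurable_fun setT xi -> measurable_fun setT t ->
  measurable_fun setT (fun p => total_collision f (x p) (xi p) (t p)).
Proof.
move=> mf mx mxi mt; apply: emeasurable_funD.
  exact: measurable_Qgain.
exact: measurable_Qloss.
Qed.

Variables (lam : evolution R n) (C : R) (x xi : 'rV[R]_n) (t : R).
Hypothesis mlam : total_measurable lam.
Hypothesis lam0 : forall y v, 0 < lam y v t.
Hypothesis C0 : 0 <= C.

Let mgain h : total_measurable h -> measurable_fun setT
  (fun p : 'rV[R]_n * 'rV[R]_n => gain_kernel h x xi t p.1 p.2).
Proof. by move=> mh; apply: measurable_gain_kernel. Qed.

Let mloss h : total_measurable h -> measurable_fun setT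
  (fun p : 'rV[R]_n * 'rV[R]_n => loss_kernel h x xi t p.1 p.2).
Proof. by move=> mh; apply: measurable_loss_kernel. Qed.

Let gain0 y w : 0 <= gain_kernel lam x xi t y w.
Proof. by rewrite mulr_ge0// addr_ge0// mulr_ge0// ltW. Qed.

Let loss0 y w : 0 <= loss_kernel lam x xi t y w.
Proof. by rewrite mulr_ge0// addr_ge0// mulr_ge0// ltW. Qed.

Lemma Qgain_ge0 : (0 <= Qgain lam lam x xi t)%E.
Proof. exact: collision_integral_ge0. Qed.

Lemma Qloss_ge0 : (0 <= Qloss lam lam x xi t)%E.
Proof. exact: collision_integral_ge0. Qed.

Lemma total_collision_ge0 : (0 <= total_collision lam x xi t)%E.
Proof. exact: adde_ge0 Qgain_ge0 Qloss_ge0. Qed.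

Let meas_scale (c : R) (h : 'rV[R]_n * 'rV[R]_n -> R) : measurable_fun setT h ->
  measurable_fun setT (fun p => c * h p).
Proof. by move=> mh; apply: measurable_funM. Qed.

Let Qgain_abs f : total_measurable f ->
  (forall y v, `|f y v t| <= C * lam y v t) ->
  (`|Qgain f f x xi t| <= (C ^+ 2)%:E * Qgain lam lam x xi t)%E.
Proof.
move=> mf fC; rewrite !QgainE -collision_integral_scale ?exprn_ge0//;
  last exact: mgain.
apply: collision_integral_abs; first exact: mgain.
  by apply: meas_scale; exact: mgain.
by move=> y w; exact: product_abs.
Qed.

Let Qloss_abs f : total_measurable f ->
  (forall y v, `|f y v t| <= C * lam y v t) ->
  (`|Qloss f f x xi t| <= (C ^+ 2)%:E * Qloss lam lam x xi t)%E.
Proof.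
move=> mf fC; rewrite !QlossE -collision_integral_scale ?exprn_ge0//;
  last exact: mloss.
apply: collision_integral_abs; first exact: mloss.
  by apply: meas_scale; exact: mloss.
by move=> y w; exact: product_abs.
Qed.

Lemma Q_abs f : total_measurable f ->
  (forall y v, `|f y v t| <= C * lam y v t) ->
  (`|Q f f x xi t| <= (C ^+ 2)%:E * total_collision lam x xi t)%E.
Proof.
move=> mf fC; apply: le_trans (lee_abs_sub _ _) _.
rewrite (ge0_muleDr _ Qgain_ge0 Qloss_ge0).
exact: leeD (Qgain_abs mf fC) (Qloss_abs mf fC).
Qed.

Variables (f g : evolution R n) (e : R).
Hypothesis e0 : 0 <= e.
Hypothesis mf : total_measurable f.
Hypothesis mg : total_measurable g.
Hypothesis fC : forall y v, `|f y v t| <= C * lam y v t.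
Hypothesis gC : forall y v, `|g y v t| <= C * lam y v t.
Hypothesis fge : forall y v, `|f y v t - g y v t| <= e * lam y v t.

Let Ce0 : 0 <= 2 * C * e.
Proof. by rewrite !mulr_ge0. Qed.

Let scaled_fin q : (0 <= q)%E -> (q < +oo)%E -> ((C ^+ 2)%:E * q < +oo)%E.
Proof. by move=> q0 qoo; rewrite lte_mul_pinfty// lee_fin exprn_ge0. Qed.

Let Qgain_sub : (Qgain lam lam x xi t < +oo)%E ->
  (`|Qgain f f x xi t - Qgain g g x xi t|
    <= (2 * C * e)%:E * Qgain lam lam x xi t)%E.
Proof.
move=> Qoo; rewrite !QgainE -collision_integral_scale//; last exact: mgain.
apply: (@collision_integral_sub _ _ _ _ _
  (fun y w => C ^+ 2 * gain_kernel lam x xi t y w)); try exact: mgain.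
- by apply: meas_scale; exact: mgain.
- by apply: meas_scale; exact: mgain.
- by move=> y w; exact: product_abs.
- by move=> y w; exact: product_abs.
- by move=> y w; exact: product_sub.
- rewrite collision_integral_scale ?exprn_ge0//; last exact: mgain.
  by apply: scaled_fin => //; exact: Qgain_ge0.
Qed.

Let Qloss_sub : (Qloss lam lam x xi t < +oo)%E ->
  (`|Qloss f f x xi t - Qloss g g x xi t|
    <= (2 * C * e)%:E * Qloss lam lam x xi t)%E.
Proof.
move=> Qoo; rewrite !QlossE -collision_integral_scale//; last exact: mloss.
apply: (@collision_integral_sub _ _ _ _ _
  (fun y w => C ^+ 2 * loss_kernel lam x xi t y w)); try exact: mloss.
- by apply: meas_scale; exact: mloss.
- by apply: meas_scale; exact: mloss.
- by move=> y w; exact: product_abs.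
- by move=> y w; exact: product_abs.
- by move=> y w; exact: product_sub.
- rewrite collision_integral_scale ?exprn_ge0//; last exact: mloss.
  by apply: scaled_fin => //; exact: Qloss_ge0.
Qed.

(** Where L is finite, the gain and loss of f and of g are finite too, each being at most C^2 times
    the corresponding term of the frame; only then may the four terms be regrouped and compared in
    pairs. *)
Lemma Q_sub : (total_collision lam x xi t < +oo)%E ->
  (`|Q f f x xi t - Q g g x xi t|
    <= (2 * C * e)%:E * total_collision lam x xi t)%E.
Proof.
have [G0 L0] := (Qgain_ge0, Qloss_ge0); rewrite /total_collision => loo.
have Goo : (Qgain lam lam x xi t < +oo)%E
  by exact: le_lt_trans (leeDl _ L0) loo.
have Loo : (Qloss lam lam x xi t < +oo)%E
  by exact: le_lt_trans (leeDr _ G0) loo.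
have fin q q' : (`|q| <= (C ^+ 2)%:E * q')%E -> (0 <= q')%E -> (q' < +oo)%E ->
    q \is a fin_num.
  by move=> qq q0 qoo; rewrite fin_num_abs; apply: le_lt_trans qq _;
    exact: scaled_fin.
have fG : Qgain f f x xi t \is a fin_num by exact: fin (Qgain_abs mf fC) G0 Goo.
have gG : Qgain g g x xi t \is a fin_num by exact: fin (Qgain_abs mg gC) G0 Goo.
have fL : Qloss f f x xi t \is a fin_num by exact: fin (Qloss_abs mf fC) L0 Loo.
have gL : Qloss g g x xi t \is a fin_num by exact: fin (Qloss_abs mg gC) L0 Loo.
rewrite (ge0_muleDr _ G0 L0).
rewrite /Q (fin_subBB fG fL gG gL).
apply: le_trans (lee_abs_sub _ _) _.
exact: leeD (Qgain_sub Goo) (Qloss_sub Loo).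
Qed.

End kernel_bounds.

(** * Integration along characteristics *)

Section time_integrals.
Context {R : realType} {n : nat}.
Implicit Types (f g lam : evolution R n) (w : R -> R).

(** Pointwise form of membership in S(C), multiplied out so that no supremum or division enters the
    estimates. *)
Definition dominated lam (C : R) f : Prop :=
  forall x xi t, 0 <= t -> `|f x xi t| <= C * lam x xi t.

(** Integrals from z to t, in either order, and integrals up to infinity all take this form with |w|
    <= 1, so the bounds below are proved once for all of them. *)
Definition weighted_collision w f x xi : \bar R :=
  (\int[lebesgue_measure]_(s in `[0%R, +oo[)
    ((w s)%:E * along (Q f f) x xi s))%E.

Lemma measurable_along
    (h : evolution R n -> 'rV[R]_n -> 'rV[R]_n -> R -> \bar R) f x xi :
  (forall (a b : R -> 'rV[R]_n) (c : R -> R), measurable_fun setT a ->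
     measurable_fun setT b -> measurable_fun setT c ->
     measurable_fun setT (fun s => h f (a s) (b s) (c s))) ->
  measurable_fun setT (along (h f) x xi).
Proof.
move=> mh; apply: mh.
- apply: measurable_rvD; first exact: measurable_cst.
  by apply: measurable_rvZ; [exact: measurable_id|exact: measurable_cst].
- exact: measurable_cst.
- exact: measurable_id.
Qed.

Lemma measurable_along_Q f x xi : total_measurable f ->
  measurable_fun setT (along (Q f f) x xi).
Proof.
by move=> mf; apply: (@measurable_along (fun f => Q f f)) => a b c;
  exact: measurable_Q.
Qed.

Variables (lam : evolution R n) (alpha : R).
Hypothesis mlam : total_measurable lam.
Hypothesis lam0 : forall x xi t, 0 <= t -> 0 < lam x xi t.
Hypothesis lamI : forall x xi,
  (\int[lebesgue_measure]_(s in `[0%R, +oo[) along (total_collision lam) x xi s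
    <= ((2 * alpha)^-1 * lam x xi 0)%:E)%E.

Let L := along (total_collision lam).

Let mL x xi : measurable_fun setT (L x xi).
Proof.
by apply: (@measurable_along total_collision) => a b c;
  exact: measurable_total_collision.
Qed.

Let L0 x xi s : 0 <= s -> (0 <= L x xi s)%E.
Proof. by move=> s0; apply: total_collision_ge0 => y v; exact: lam0. Qed.

Variable C : R.
Hypothesis C0 : 0 < C.

Section one_function.
Variable f : evolution R n.
Hypothesis mf : total_measurable f.
Hypothesis fC : dominated lam C f.

Lemma along_Q_abs x xi s : 0 <= s ->
  (`|along (Q f f) x xi s| <= (C ^+ 2)%:E * L x xi s)%E.
Proof.
move=> s0; apply: Q_abs => //; [|exact: ltW|] => y v; [exact: lam0|exact: fC].
Qed.

Lemma along_Q_integrable x xi :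
  lebesgue_measure.-integrable `[0, +oo[ (along (Q f f) x xi).
Proof.
have mI : measurable (`[0, +oo[ : set R) by [].
apply: (@le_integrable _ _ _ lebesgue_measure _ mI _ (fun s =>
  (C ^+ 2)%:E * L x xi s)%E).
- exact: measurable_funTS (measurable_along_Q _ _ mf).
- move=> s; rewrite /= in_itv/= andbT => s0;
    apply: le_trans (along_Q_abs _ _ s0) _.
  exact: lee_abs.
- apply: integrableZl => //; apply/integrableP; split;
    first exact: measurable_funTS (mL x xi).
  under eq_integral.
    move=> s; rewrite inE/= in_itv/= andbT => s0; rewrite gee0_abs ?L0//; over.
  exact: le_lt_trans (lamI x xi) (ltry _).
Qed.

Lemma weighted_integrable w x xi : measurable_fun setT w ->
  (forall s, `|w s| <= 1) ->
  lebesgue_measure.-integrable `[0, +oo[ (fun s =>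
    (w s)%:E * along (Q f f) x xi s)%E.
Proof.
move=> mw w1; apply: le_integrable (along_Q_integrable x xi) => //.
  apply: measurable_funTS; apply: emeasurable_funM;
    first exact/measurable_EFinP.
  exact: measurable_along_Q.
by move=> s _; rewrite abseM /= -[leRHS]mul1e lee_wpmul2r// lee_fin.
Qed.

(** Distributivity may fail where Q is infinite: for w1 = w2 = 1 and Q = +oo, the left integrand is
    0 and the right one is -oo. Integrability makes such times negligible. *)
Lemma weighted_collisionB w1 w2 x xi :
  measurable_fun setT w1 -> measurable_fun setT w2 ->
  (forall s, `|w1 s| <= 1) -> (forall s, `|w2 s| <= 1) ->
  weighted_collision (fun s => w1 s - w2 s) f x xi =
  (weighted_collision w1 f x xi - weighted_collision w2 f x xi)%E.
Proof.
move=> mw1 mw2 w1b w2b; rewrite -integralB//; [|exact: weighted_integrable..].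
have mI : measurable (`[0, +oo[ : set R) by [].
have mk w : measurable_fun setT w ->
    measurable_fun (`[0, +oo[ : set R) (fun s =>
      (w s)%:E * along (Q f f) x xi s)%E.
  move=> mw; apply: measurable_funTS; apply: emeasurable_funM.
    exact/measurable_EFinP.
  exact: measurable_along_Q.
apply: ae_eq_integral => //.
- by apply: mk; exact: measurable_funB.
- by apply: emeasurable_funB; exact: mk.
- have := @integrable_ae _ _ _ lebesgue_measure `[0, +oo[ (measurable_itv _)
    _ (along_Q_integrable x xi).
  apply: filterS => s fs /fs /fineK <-.
  by rewrite -!EFinM -EFinB; congr EFin; ring.
Qed.

Lemma weighted_collision_indic (A : set R)
  x xi : measurable A -> A `<=` `[0, +oo[ ->
  weighted_collision \1_A f x xi =
  (\int[lebesgue_measure]_(s in A) along (Q f f) x xi s)%E.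
Proof.
move=> mA A0; rewrite -[in RHS](setIidr A0) [RHS]integral_mkcondr.
apply: eq_integral => s _; rewrite patchE indicE.
by case: ifP => _; rewrite ?mul1e ?mul0e.
Qed.

Lemma weighted_collision_fin w x xi : measurable_fun setT w ->
  (forall s, `|w s| <= 1) -> weighted_collision w f x xi \is a fin_num.
Proof. by move=> mw w1; apply: integrable_fin_num => //;
  exact: weighted_integrable. Qed.

(** Taking D = [0, oo[ will give the invariance of S(N), and D = [t, oo[ or [z, oo[ the distances to
    the outgoing profile. *)
Lemma weighted_collision_abs w (D : set R) x xi : measurable_fun setT w ->
  measurable D -> D `<=` `[0, +oo[ -> (forall s, 0 <= s -> `|w s| <= \1_D s) ->
  (`|weighted_collision w f x xi|
    <= (C ^+ 2)%:E * \int[lebesgue_measure]_(s in D) L x xi s)%E.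
Proof.
move=> mw mD D0 wD.
have mI : measurable (`[0, +oo[ : set R) by [].
have mk : measurable_fun (`[0, +oo[ : set R) (fun s =>
  (w s)%:E * along (Q f f) x xi s)%E.
  apply: measurable_funTS; apply: emeasurable_funM;
    first exact/measurable_EFinP.
  exact: measurable_along_Q.
have mCL : measurable_fun setT (fun s => (C ^+ 2)%:E * L x xi s)%E.
  by apply: emeasurable_funM => //; exact: measurable_cst.
apply: le_trans (@le_abse_integral _ _ _ lebesgue_measure _ _ mI mk) _.
rewrite -ge0_integralZl_EFin//; last 3 first.
- by move=> s /D0; rewrite /= in_itv/= andbT; exact: L0.
- exact: measurable_funTS (mL x xi).
- by rewrite exprn_ge0// ltW.
rewrite -[in leRHS](setIidr D0) [leRHS]integral_mkcondr.
apply: ge0_le_integral => //.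
- exact: measurableT_comp.
- by apply/measurable_restrict => //; exact: measurable_funTS mCL.
- move=> s; rewrite /= in_itv/= andbT => s0; rewrite abseM patchE /=.
  have := wD s s0; rewrite indicE; case: ifPn => _ ws.
    apply: le_trans (along_Q_abs _ _ s0).
    by rewrite -[leRHS]mul1e lee_wpmul2r// lee_fin.
  by rewrite (_ : `|w s| = 0) ?mul0e//; apply/eqP; rewrite eq_le ws normr_ge0.
Qed.

End one_function.

Lemma weighted_collision_sub f g e w x xi :
  total_measurable f -> total_measurable g ->
  dominated lam C f -> dominated lam C g -> 0 <= e ->
  dominated lam e (fun x xi t => f x xi t - g x xi t) ->
  measurable_fun setT w -> (forall s, `|w s| <= 1) ->
  (`|weighted_collision w f x xi - weighted_collision w g x xi|
    <= (2 * C * e)%:E * \int[lebesgue_measure]_(s in `[0%R, +oo[) L x xi s)%E.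
Proof.
move=> mf mg fC gC e0 fge mw w1.
have Ce0 : 0 <= 2 * C * e by rewrite !mulr_ge0// ltW.
have mI : measurable (`[0, +oo[ : set R) by [].
have mk h : total_measurable h ->
    measurable_fun (`[0, +oo[ : set R) (fun s =>
      (w s)%:E * along (Q h h) x xi s)%E.
  move=> mh; apply: measurable_funTS; apply: emeasurable_funM;
    first exact/measurable_EFinP.
  exact: measurable_along_Q.
have kb h s : total_measurable h -> dominated lam C h -> `[0, +oo[%classic s ->
    (`|(w s)%:E * along (Q h h) x xi s| <= (C ^+ 2)%:E * L x xi s)%E.
  rewrite /= in_itv/= andbT => mh hC s0;
    apply: le_trans (along_Q_abs mh hC _ _ s0).
  by rewrite abseM /= -[leRHS]mul1e lee_wpmul2r// lee_fin.
have Lge0 s : `[0, +oo[%classic s -> (0 <= L x xi s)%E.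
  by rewrite /= in_itv/= andbT; exact: L0.
have mcL c : measurable_fun (`[0, +oo[ : set R) (fun s => c%:E * L x xi s)%E.
  by apply: measurable_funTS; apply: emeasurable_funM => //;
    exact: measurable_cst.
rewrite -ge0_integralZl_EFin//; last exact: measurable_funTS (mL x xi).
rewrite /weighted_collision;
  apply: (@integral_sub_le _ _ _ lebesgue_measure _ _ _ _ (fun s =>
    (C ^+ 2)%:E * L x xi s)%E) => //.
- exact: mk.
- exact: mk.
- exact: mcL.
- exact: mcL.
- by move=> s Is; apply: mule_ge0; [rewrite lee_fin|exact: Lge0].
- by move=> s; exact: kb.
- by move=> s; exact: kb.
- move=> s Is CLoo; have s0 : 0 <= s by move: Is; rewrite /= in_itv/= andbT.
  (* Finiteness passes from C^2 L to L because C > 0. *)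
  have Loo : (L x xi s < +oo)%E.
    move: CLoo; case: (L x xi s) (Lge0 _ Is) => // [r _ _|_]; first exact: ltry.
    by rewrite gt0_muley ?ltxx// lte_fin exprn_gt0.
  have Qfin h : total_measurable h -> dominated lam C h -> along (Q h h)
    x xi s \is a fin_num.
    move=> mh hC; rewrite fin_num_abs;
      apply: le_lt_trans (along_Q_abs mh hC _ _ s0) _.
    exact: CLoo.
  rewrite -muleBr//; last by apply: fin_num_adde_defr; exact: Qfin.
  rewrite abseM /= -[leRHS]mul1e; apply: lee_pmul => //;
    first by rewrite lee_fin.
  apply: Q_sub => //; try exact: ltW; try by move=> y v; exact: lam0.
  + by move=> y v; exact: fC.
  + by move=> y v; exact: gC.
  + by move=> y v; exact: fge.
- rewrite ge0_integralZl_EFin//;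
    [|exact: measurable_funTS (mL x xi)|by rewrite exprn_ge0// ltW].
  rewrite lte_mul_pinfty ?lee_fin ?exprn_ge0 ?ltW//.
  exact: le_lt_trans (lamI x xi) (ltry _).
Qed.

End time_integrals.

(** * Fixed points of the integrated equation *)

Section duhamel.
Context {R : realType} {n : nat}.
Implicit Types (f : evolution R n) (t z : R).

(* Signed weight turning an integral over [0, +oo[ into the oriented integral
   from z to t, so that both orders of z and t are handled at once. *)
Definition window t z (s : R) : R := \1_`[0, t] s - \1_`[0, z] s.

Lemma window_abs t z s : `|window t z s| <= 1.
Proof. by rewrite /window !indicE; do 2 case: (_ \in _); rewrite /= ler_norml;
  lra. Qed.

Lemma measurable_window t z : measurable_fun setT (window t z).
Proof. by apply: measurable_funB; exact: measurable_indic. Qed.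

(** The right-hand side of the integrated equation, read at the foot x - t xi of the characteristic.
    Negative times receive the value at time 0, and [fine] loses nothing on S(N), where the integral
    is finite. *)
Definition duhamel (g0 : 'rV[R]_n -> 'rV[R]_n -> R) z f : evolution R n :=
  fun x xi t => let t' := Num.max t 0 in
    g0 (x - t' *: xi) xi
    + fine (weighted_collision (window t' z) f (x - t' *: xi) xi).

Lemma duhamel_along g0 z f x xi t : 0 <= t ->
  duhamel g0 z f (x + t *: xi) xi t =
  g0 x xi + fine (weighted_collision (window t z) f x xi).
Proof. by move=> t0; rewrite /duhamel /= (max_l t0) addrK. Qed.

Lemma duhamel_initial g0 f x xi : duhamel g0 0 f x xi 0 = g0 x xi.
Proof.
have := duhamel_along g0 0 f x xi (lexx 0); rewrite scale0r addr0 => ->.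
rewrite /weighted_collision integral0_eq ?addr0// => s _.
by rewrite /window subrr mul0e.
Qed.

Lemma measurable_weighted_collision d (T : measurableType d) (w : T -> R -> R) f
    (x xi : T -> 'rV[R]_n) : total_measurable f ->
  measurable_fun [set: T * R] (fun p => w p.1 p.2) ->
  measurable_fun setT x -> measurable_fun setT xi ->
  measurable_fun setT (fun p => weighted_collision (w p) f (x p) (xi p)).
Proof.
move=> mf mw mx mxi.
apply: (@measurable_integral_section _ _ _ _ _ lebesgue_measure `[0, +oo[
  (fun p : T * R => (w p.1 p.2)%:E * along (Q f f) (x p.1) (xi p.1) p.2)%E)
    => //.
apply: emeasurable_funM; first exact/measurable_EFinP.
have m1 : measurable_fun setT (fun p : T * R =>
  xi p.1) by exact: measurableT_comp.
apply: measurable_Q => //; apply: measurable_rvD; first exact: measurableT_comp.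
by apply: measurable_rvZ => //; exact: measurable_snd.
Qed.

(** The region 0 <= s <= t(p) is cut out of the product by two measurable inequalities, which makes
    the weight jointly measurable in its moving endpoint and in time, as Tonelli requires. *)
Lemma measurable_window2 d (T : measurableType d) (t : T -> R) z :
  measurable_fun setT t ->
  measurable_fun [set: T * R] (fun p => window (t p.1) z p.2).
Proof.
move=> mt; apply: measurable_funB; last first.
  by apply: measurableT_comp => //; exact: measurable_indic.
pose E : set (T * R) := snd @^-1` `[0, +oo[ `&` (fun p =>
  t p.1 - p.2) @^-1` `[0, +oo[.
rewrite (_ : (fun p : T * R => \1_(`[0, t p.1] : set R) p.2) = \1_E).
  apply: measurable_indic; apply: measurableI;
    rewrite -[X in measurable X]setTI.
    exact: measurable_snd.
  have : measurable_fun setT (fun p : T * R => t p.1 - p.2).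
    by apply: measurable_funB => //; exact: measurableT_comp.
  exact.
apply/funext => p; rewrite !indicE; congr ((nat_of_bool _)%:R).
apply/idP/idP; rewrite !inE /E /= !in_itv/= !andbT subr_ge0; first by case/andP.
by move=> [-> ->].
Qed.

Lemma measurable_duhamel g0 z f : total_measurable f ->
  measurable_fun setT (fun p : 'rV[R]_n * 'rV[R]_n => g0 p.1 p.2) ->
  total_measurable (duhamel g0 z f).
Proof.
move=> mf mg0; rewrite /total_measurable /duhamel /=.
pose P := ('rV[R]_n * 'rV[R]_n * R)%type.
have mt : measurable_fun setT (fun p : P => Num.max p.2 0).
  by apply: measurable_maxr => //; exact: measurable_snd.
have mxi : measurable_fun setT (fun p : P => p.1.2).
  exact: measurableT_comp measurable_snd measurable_fst.
have my : measurable_fun setT (fun p : P => p.1.1 - Num.max p.2 0 *: p.1.2).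
  apply: measurable_rvB; first exact: measurableT_comp measurable_fst
    measurable_fst.
  exact: measurable_rvZ.
apply: measurable_funD.
  apply: (measurableT_comp mg0 (g := fun p : P =>
    (p.1.1 - Num.max p.2 0 *: p.1.2, p.1.2))).
  exact: measurable_fun_pair.
apply: measurableT_comp => //.
apply: (@measurable_weighted_collision _ P
  (fun p => window (Num.max p.2 0) z)) => //.
exact: (@measurable_window2 _ _ (fun p : P => Num.max p.2 0)).
Qed.

Lemma weighted_collision_window lam alpha C f x xi t z : total_measurable lam ->
  (forall x xi t, 0 <= t -> 0 < lam x xi t) ->
  (forall x xi,
    (\int[lebesgue_measure]_(s in `[0%R, +oo[) along (total_collision lam)
      x xi s
      <= ((2 * alpha)^-1 * lam x xi 0)%:E)%E) ->
  0 < C -> total_measurable f -> dominated lam C f ->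
  weighted_collision (window t z) f x xi =
  (\int[lebesgue_measure]_(s in `[0%R, t]) along (Q f f) x xi s
   - \int[lebesgue_measure]_(s in `[0%R, z]) along (Q f f) x xi s)%E.
Proof.
move=> mlam lam0 lamI C0 mf fC.
rewrite (weighted_collisionB mlam lam0 lamI C0 mf fC) //;
  try (by move=> s; rewrite indicE; case: (_ \in _); rewrite ?normr1 ?normr0);
  try exact: measurable_indic.
rewrite !weighted_collision_indic//.
- by move=> s; rewrite /= !in_itv/= => /andP[->].
- by move=> s; rewrite /= !in_itv/= => /andP[->].
Qed.

End duhamel.

(** * Contraction, fixed point and outgoing profile *)

Section fixed_point.
Context {R : realType} {n : nat}.
Variables (lam : evolution R n) (alpha N : R).
Hypothesis mlam : total_measurable lam.
Hypothesis lam0 : forall x xi t, 0 <= t -> 0 < lam x xi t.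
Hypothesis lamT : forall x xi t, 0 <= t -> lam (x + t *: xi) xi t = lam x xi 0.
Hypothesis lamI : forall x xi,
  (\int[lebesgue_measure]_(s in `[0%R, +oo[) along (total_collision lam) x xi s
    <= ((2 * alpha)^-1 * lam x xi 0)%:E)%E.
Hypothesis N0 : 0 < N.
Hypothesis Nalpha : N < alpha.

Let alpha0 : 0 < alpha. Proof. exact: lt_trans Nalpha. Qed.

(** The frame is constant along characteristics, so along each of them a bound at any time can be
    tested against lam at time 0. *)
Lemma dominatedP C f : dominated lam C f <->
  forall x xi t, 0 <= t -> `|f (x + t *: xi) xi t| <= C * lam x xi 0.
Proof.
split=> H x xi t t0; first by rewrite -(lamT x xi t0); exact: H.
by rewrite -[x](subrK (t *: xi)) lamT//; exact: H.
Qed.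

Variables (g0 : 'rV[R]_n -> 'rV[R]_n -> R) (z : R).
Hypothesis mg0 : measurable_fun setT (fun p : 'rV[R]_n * 'rV[R]_n =>
  g0 p.1 p.2).
Hypothesis g0N : forall x xi, `|g0 x xi| <= 2^-1 * N * lam x xi 0.

(** The origin of the half in the size of the data: N / 2 is spent on g0, and the collisions cost
    N^2 / (2 alpha) <= N / 2 because N < alpha. *)
Lemma weighted_collision_le f (w : R -> R)
  x xi : total_measurable f -> dominated lam N f ->
  measurable_fun setT w -> (forall s, `|w s| <= 1) ->
  `|g0 x xi + fine (weighted_collision w f x xi)| <= N * lam x xi 0.
Proof.
move=> mf fN mw w1.
have WF := weighted_collision_fin mlam lam0 lamI N0 mf fN x xi mw w1.
have W : `|fine (weighted_collision w f x xi)| <= N ^+ 2 * ((2 * alpha)^-1 *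
  lam x xi 0).
  rewrite -lee_fin EFinM -[X in (X <= _)%E]abse_EFin fineK//.
  apply: le_trans (weighted_collision_abs mlam lam0 N0 mf fN (D := `[0, +oo[)
    x xi mw _ _ _) _ => //.
    by move=> s s0; rewrite indicE mem_set// /= in_itv/= s0.
  by rewrite lee_wpmul2l ?lee_fin ?exprn_ge0// ltW.
apply: le_trans (ler_normD _ _) _; apply: le_trans (lerD (g0N x xi) W) _.
rewrite mulrA -mulrDl ler_pM2r ?lam0//.
have : N ^+ 2 / (2 * alpha) <= N / 2.
  by rewrite ler_pdivrMr ?mulr_gt0// expr2 -mulrA ler_pM2l// mulKf// ltW.
by lra.
Qed.

Lemma duhamel_dominated f : total_measurable f -> dominated lam N f ->
  dominated lam N (duhamel g0 z f).
Proof.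
move=> mf fN; apply/dominatedP => x xi t t0; rewrite duhamel_along//.
apply: weighted_collision_le => //; first exact: measurable_window.
exact: window_abs.
Qed.

(** The term g0 cancels, and the bilinear constant 2 N e meets the bound (2 alpha)^-1 on the
    integral of L. *)
Lemma duhamel_contraction f g e : total_measurable f -> total_measurable g ->
  dominated lam N f -> dominated lam N g -> 0 <= e ->
  dominated lam e (fun x xi t => f x xi t - g x xi t) ->
  dominated lam (N / alpha * e)
    (fun x xi t => duhamel g0 z f x xi t - duhamel g0 z g x xi t).
Proof.
move=> mf mg fN gN e0 fge; apply/dominatedP => x xi t t0;
  rewrite !duhamel_along//.
have mw := measurable_window t z; have w1 := window_abs t z.
have fF := weighted_collision_fin mlam lam0 lamI N0 mf fN x xi mw w1.
have gF := weighted_collision_fin mlam lam0 lamI N0 mg gN x xi mw w1.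
have := weighted_collision_sub mlam lam0 lamI N0 x xi mf mg fN gN e0 fge mw w1.
move: fF gF; generalize (weighted_collision (window t z) f x xi).
generalize (weighted_collision (window t z) g x xi) => b a /fineK <- /fineK <-.
rewrite /= opprD addrACA subrr add0r => W.
rewrite -lee_fin; apply: le_trans W _.
apply: (@le_trans _ _ ((2 * N * e)%:E * ((2 * alpha)^-1 * lam x xi 0)%:E)%E).
  by rewrite lee_wpmul2l// lee_fin !mulr_ge0// ltW.
by rewrite -EFinM lee_fin le_eqVlt; apply/orP; left; apply/eqP; field;
  rewrite gt_eqF.
Qed.

Let q01 : 0 <= N / alpha < 1.
Proof. by rewrite divr_ge0 ?(ltW N0, ltW alpha0)//= ltr_pdivrMr// mul1r. Qed.

Lemma duhamel_unique f g : total_measurable f -> total_measurable g ->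
  dominated lam N f -> dominated lam N g ->
  (forall x xi t, 0 <= t -> f x xi t = duhamel g0 z f x xi t) ->
  (forall x xi t, 0 <= t -> g x xi t = duhamel g0 z g x xi t) ->
  eq_evolution f g.
Proof.
move=> mf mg fN gN fE gE.
(* The distance is at most 2 N by the triangle inequality; each use of the equation multiplies it by
   N / alpha. *)
have H k : dominated lam (2 * N * (N / alpha) ^+ k) (fun x xi t =>
  f x xi t - g x xi t).
  elim: k => [|k IH] x xi t t0.
    apply: le_trans (ler_normB _ _) _;
      have := lerD (fN x xi t t0) (gN x xi t t0).
    by rewrite expr0; lra.
  rewrite fE// gE// exprS mulrCA; apply: duhamel_contraction => //.
  apply: mulr_ge0; first by rewrite mulr_ge0// ltW.
  by apply: exprn_ge0; case/andP: q01.
move=> x xi t t0; apply/eqP; rewrite -subr_eq0 -normr_le0.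
apply: (@geometric_le0 _ (2 * N * lam x xi t) (N / alpha)) => // k.
by rewrite mulrAC; exact: H.
Qed.

(** Picard iteration from 0. The limit is taken at each point separately and is measurable as a
    pointwise limit; the geometric rate, uniform relative to lam, carries the bound N and the
    equation over to it. *)
Lemma duhamel_fixpoint : exists f : evolution R n,
  [/\ total_measurable f, dominated lam N f &
      forall x xi t, 0 <= t -> f x xi t = duhamel g0 z f x xi t].
Proof.
pose F k := iter k (duhamel g0 z) (fun _ _ _ => 0).
have mF k : total_measurable (F k).
  elim: k => [|k IH]; first exact: measurable_cst.
  exact: measurable_duhamel.
have FN k : dominated lam N (F k).
  elim: k => [|k IH]; last exact: duhamel_dominated.
  by move=> x xi t t0; rewrite normr0 mulr_ge0// ltW// lam0.
have [q0 q1] := andP q01.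
have Fstep k : dominated lam (N * (N / alpha) ^+ k)
    (fun x xi t => F k.+1 x xi t - F k x xi t).
  elim: k => [|k IH].
    by move=> x xi t t0; rewrite subr0 expr0 mulr1; exact: (FN 1%N).
  rewrite exprS mulrCA.
  apply: (duhamel_contraction (mF k.+1) (mF k) (FN k.+1) (FN k) _ IH).
  by rewrite mulr_ge0 ?exprn_ge0// ltW.
(* The sum of all the steps N (N / alpha)^k. *)
pose c := N / (1 - N / alpha).
have [l lF] : exists l : evolution R n, forall x xi t, 0 <= t -> forall k,
    `|l x xi t - F k x xi t| <= c * (N / alpha) ^+ k * lam x xi t.
  (* With the time condition inside the existential, choice yields a total function; negative times
     get 0. *)
  suff H : forall p : 'rV[R]_n * 'rV[R]_n * R, exists l, 0 <= p.2 -> forall k,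
      `|l - F k p.1.1 p.1.2 p.2| <= c * (N / alpha) ^+ k * lam p.1.1 p.1.2 p.2.
    have [l lP] := choice H.
    by exists (fun x xi t => l (x, xi, t)) => x xi t t0; exact: (lP (x, xi, t)).
  move=> [[x xi] t] /=; case: (leP 0 t) => t0; last by exists 0.
  have [|l lP] := @geometric_step_limit _ (fun k =>
    F k x xi t) (N * lam x xi t) _ q01.
    by move=> k; rewrite mulrAC; exact: Fstep.
  exists l => _ k; apply: le_trans (lP k) _.
  by rewrite /c le_eqVlt; apply/orP; left; apply/eqP; ring.
(* Convergence is known only for t >= 0; reading l at max(t, 0) makes f a pointwise limit on the
   whole product. *)
pose f : evolution R n := fun x xi t => l x xi (Num.max t 0).
have fF k : dominated lam (c * (N / alpha) ^+ k) (fun x xi t =>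
  f x xi t - F k x xi t).
  by move=> x xi t t0; rewrite /f (max_l t0); exact: lF.
have cvg0 a : (c * (N / alpha) ^+ k * a) @[k --> \oo] --> (0 : R).
  by under eq_fun do rewrite mulrAC; exact: geometric_cvg0.
have mf : total_measurable f.
  pose Fmax k (p : 'rV[R]_n * 'rV[R]_n * R) := F k p.1.1 p.1.2 (Num.max p.2 0).
  apply: (@measurable_fun_cvg _ _ _ _ Fmax) => [k|[[x xi] t] _].
    apply: measurable_evolution_comp => //.
    - exact: measurableT_comp measurable_fst measurable_fst.
    - exact: measurableT_comp measurable_snd measurable_fst.
    - by apply: measurable_maxr => //; exact: measurable_snd.
  rewrite /Fmax /f /=; set t' := Num.max t 0.
  have t0 : 0 <= t' by rewrite le_max lexx orbT.
  apply/cvgrPdist_le => e e0;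
    move/cvgrPdist_le : (cvg0 (lam x xi t')) => /(_ e e0).
  apply: filterS => k; rewrite sub0r normrN; apply: le_trans.
  exact: le_trans (lF x xi t' t0 k) (ler_norm _).
have fN : dominated lam N f.
  move=> x xi t t0; rewrite -subr_le0.
  apply: (@geometric_le0 _ (c * lam x xi t) (N / alpha)) => // k.
  have := fF k x xi t t0; have := FN k x xi t t0.
  have := ler_normD (f x xi t - F k x xi t) (F k x xi t); rewrite subrK.
  by rewrite [c * _ * lam x xi t]mulrAC; lra.
exists f; split => // x xi t t0.
apply/eqP; rewrite -subr_eq0 -normr_le0.
apply: (@geometric_le0 _ (2 * (c * lam x xi t)) (N / alpha)) => // k.
have c0 : 0 <= c * (N / alpha) ^+ k.
  by rewrite mulr_ge0 ?exprn_ge0// /c divr_ge0 ?subr_ge0// ltW.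
have := duhamel_contraction mf (mF k) fN (FN k) c0 (fF k) x xi t0.
have := fF k.+1 x xi t t0; rewrite -[F k.+1]/(duhamel g0 z (F k)) => A B.
(* The triangle inequality goes through the next iterate: its distance to f is bounded by the rate,
   and its distance to the image of f by the contraction. *)
have := ler_distD (duhamel g0 z (F k) x xi t) (f x xi t)
  (duhamel g0 z f x xi t).
move/le_trans; apply; rewrite [X in _ + X]distrC; apply: le_trans (lerD A B) _.
have lt0 := ltW (lam0 x xi t0).
have qle : c * (N / alpha) ^+ k * (N / alpha) * lam x xi t
    <= c * (N / alpha) ^+ k * lam x xi t by rewrite ler_wpM2r// ler_piMr// ltW.
rewrite exprS; apply: (@le_trans _ _ (2 * (c * (N / alpha) ^+ k * (N / alpha)
  * lam x xi t))).
  by rewrite le_eqVlt; apply/orP; left; apply/eqP; ring.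
have -> : 2 * (c * lam x xi t) * (N / alpha) ^+ k = 2 * (c * (N / alpha)
  ^+ k * lam x xi t) by ring.
by rewrite ler_pM2l.
Qed.

Variable f : evolution R n.
Hypothesis mf : total_measurable f.
Hypothesis fN : dominated lam N f.

(** At t = 0 the equation reads f(x, xi, 0) = g0 - int_0^z Q(f, f); eliminating g0 turns the
    integral from z into one from 0. *)
Lemma fixpoint_boltzmann :
  (forall x xi t, 0 <= t -> f x xi t = duhamel g0 z f x xi t) ->
  boltzmann_solution f.
Proof.
move=> fE; split; first exact: measurable_funTS mf.
move=> x xi t t0.
have iQ (r : R) : lebesgue_measure.-integrable `[0, r] (along (Q f f) x xi).
  apply: (@integrableS _ _ _ lebesgue_measure `[0, +oo[); last first.
  - exact: (along_Q_integrable mlam lam0 lamI N0 mf fN).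
  - by move=> s; rewrite /= !in_itv/= => /andP[->].
  - by [].
  - by [].
split; first exact: iQ.
pose I (r : R) := (\int[lebesgue_measure]_(s in `[0%R, r]) along (Q f f)
  x xi s)%E.
have fin r : I r \is a fin_num by apply: integrable_fin_num (iQ r).
have W r : weighted_collision (window r z) f x xi = (I r - I z)%E.
  exact: (weighted_collision_window _ _ _ _ mlam lam0 lamI N0 mf fN).
have I0 : I 0 = 0%E by rewrite /I set_itv1 integral_set1.
have f0E := duhamel_along g0 z f x xi (lexx 0).
rewrite scale0r addr0 -fE// W I0 sub0e in f0E.
rewrite fE// duhamel_along// W f0E.
transitivity ((g0 x xi + fine (- I z))%:E + I t)%E; last by [].
move: (fin t) (fin z); generalize (I t) (I z).
by move=> [a| |]// [b| |]// _ _; rewrite /= -EFinD; congr EFin; ring.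
Qed.

(** The value of [duhamel] along a characteristic with the end t of the window sent to infinity. *)
Definition outgoing (x xi : 'rV[R]_n) : R :=
  g0 x xi + fine (weighted_collision (fun s =>
    \1_`[0, +oo[ s - \1_`[0, z] s) f x xi).

Let tail_weight (r s : R) : R := \1_`[0, +oo[ s - \1_`[0, r] s.

Let tail_weight1 r s : `|tail_weight r s| <= 1.
Proof. by rewrite /tail_weight !indicE; do 2 case: (_ \in _);
  rewrite /= ler_norml; lra. Qed.

Let mtail_weight r : measurable_fun setT (tail_weight r).
Proof. by apply: measurable_funB; exact: measurable_indic. Qed.

Let tail_weight_le r s : 0 <= r -> 0 <= s -> `|tail_weight r s| <= \1_`[r,
  +oo[ s.
Proof.
move=> r0 s0; rewrite /tail_weight !indicE !mem_setE !in_itv/= s0 /=.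
by case: (leP s r) => [sr|/ltW ->]; rewrite ?subrr ?normr0 ?subr0 ?normr1.
Qed.

Let tail_sub (r : R) : 0 <= r -> (`[r, +oo[ : set R) `<=` `[0, +oo[.
Proof. by move=> r0 s; rewrite /= !in_itv/= !andbT; exact: le_trans. Qed.

Lemma measurable_outgoing :
  measurable_fun setT (fun p : 'rV[R]_n * 'rV[R]_n => outgoing p.1 p.2).
Proof.
apply: measurable_funD => //; apply: measurableT_comp => //.
apply: (@measurable_weighted_collision _ _ _ _ (fun=> tail_weight z)) => //.
by apply: (measurableT_comp (mtail_weight z)); exact: measurable_snd.
Qed.

Lemma outgoing_dominated x xi : `|outgoing x xi| <= N * lam x xi 0.
Proof.
exact: (weighted_collision_le _ _ mf fN (mtail_weight z) (tail_weight1 z)).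
Qed.

Lemma outgoing_initial x xi : 0 <= z ->
  (`|(g0 x xi - outgoing x xi)%:E| <= (N ^+ 2)%:E *
    \int[lebesgue_measure]_(s in `[z, +oo[) along (total_collision lam)
      x xi s)%E.
Proof.
move=> z0.
have F := weighted_collision_fin mlam lam0 lamI N0 mf fN x xi (mtail_weight z)
  (tail_weight1 z).
rewrite /outgoing opprD addrA subrr add0r EFinN abseN fineK//.
apply: weighted_collision_abs => //; first exact: mtail_weight.
- exact: tail_sub.
- by move=> s s0; exact: tail_weight_le.
Qed.

(** When the weight from z to t is subtracted from the weight of the profile, z drops out and the
    indicator of ]t, oo[ remains; the rate is thus the same for all z. *)
Lemma outgoing_limit x xi t : 0 <= t ->
  (forall x xi t, 0 <= t -> f x xi t = duhamel g0 z f x xi t) ->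
  (`|(f (x + t *: xi) xi t - outgoing x xi)%:E| <= (N ^+ 2)%:E *
    \int[lebesgue_measure]_(s in `[t, +oo[) along (total_collision lam)
      x xi s)%E.
Proof.
move=> t0 fE; rewrite fE// duhamel_along//.
have F1 := weighted_collision_fin mlam lam0 lamI N0 mf fN x xi
  (measurable_window t z) (window_abs t z).
have F2 := weighted_collision_fin mlam lam0 lamI N0 mf fN x xi (mtail_weight z)
  (tail_weight1 z).
have := weighted_collisionB mlam lam0 lamI N0 mf fN x xi (mtail_weight z)
  (measurable_window t z) (tail_weight1 z) (window_abs t z).
have wE : (fun s => tail_weight z s - window t z s) = tail_weight t.
  by apply/funext => s; rewrite /tail_weight /window; ring.
rewrite wE /outgoing -/(tail_weight z).
have := weighted_collision_abs mlam lam0 N0 mf fN (D := `[t, +oo[)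
  x xi (mtail_weight t) _ (tail_sub t0) _.
move=> /(_ (measurable_itv _) (fun s => tail_weight_le t0)).
move: F1 F2; generalize (weighted_collision (tail_weight t) f x xi).
generalize (weighted_collision (window t z) f x xi).
generalize (weighted_collision (tail_weight z) f x xi).
move=> [a| |]// [b| |]// c _ _ H E; move: H; rewrite {}E /=.
have -> : g0 x xi + b - (g0 x xi + a) = - (a - b) by ring.
by rewrite normrN.
Qed.

Lemma abs_collision_tail_le x xi r : 0 <= r ->
  (abs_collision_tail f r x xi <= (N ^+ 2)%:E *
    \int[lebesgue_measure]_(s in `[r, +oo[) along (total_collision lam)
      x xi s)%E.
Proof.
move=> r0; have r0' (s : R) : `[r, +oo[%classic s -> 0 <= s.
  by rewrite /= in_itv/= andbT; exact: le_trans.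
have L0 s : 0 <= s -> (0 <= along (total_collision lam) x xi s)%E.
  by move=> s0; apply: total_collision_ge0 => y v; exact: lam0.
have mL : measurable_fun setT (along (total_collision lam) x xi).
  by apply: (@measurable_along _ _ total_collision) => a b c;
    exact: measurable_total_collision.
rewrite -ge0_integralZl_EFin//; last 3 first.
- by move=> s /r0'; exact: L0.
- exact: measurable_funTS mL.
- by rewrite exprn_ge0// ltW.
apply: ge0_le_integral => //.
- apply: measurableT_comp => //;
    exact: measurable_funTS (measurable_along_Q x xi mf).
- apply: measurable_funTS; apply: emeasurable_funM => //; exact: measurable_cst.
- by move=> s /r0' s0; exact: (along_Q_abs mlam lam0 N0 mf fN).
Qed.

End fixed_point.

(** * Scattering in the norms of the frame *)

Section clamped_time.
Context {R : realType} {n : nat}.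
Implicit Types f g : evolution R n.

(* Agrees with f for t >= 0, and is measurable on the whole product even though f
   is only constrained for t >= 0. *)
Definition clamp f : evolution R n := fun x xi t => f x xi (Num.max t 0).

Lemma clampE f x xi t : 0 <= t -> clamp f x xi t = f x xi t.
Proof. by move=> t0; rewrite /clamp (max_l t0). Qed.

Lemma measurable_clamp f : measurable_evolution f -> total_measurable (clamp f).
Proof.
move=> mf; pose P := ('rV[R]_n * 'rV[R]_n * R)%type.
apply: (@measurable_comp _ _ _ _ _ _ [set p : P | 0 <= p.2]
  (fun p : P => f p.1.1 p.1.2 p.2) setT (fun p : P =>
    (p.1, Num.max p.2 0))) => //.
- rewrite (_ : mkset _ = snd @^-1` `[0, +oo[).
    by rewrite -[X in measurable X]setTI; exact: measurable_snd.
  by apply/seteqP; split=> p /=; rewrite in_itv/= andbT.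
- by move=> _ [p _ <-] /=; rewrite le_max lexx orbT.
- apply: measurable_fun_pair; first exact: measurable_fst.
  by apply: measurable_maxr => //; exact: measurable_snd.
Qed.

Lemma Qgain_clamp f x xi t : 0 <= t ->
  Qgain (clamp f) (clamp f) x xi t = Qgain f f x xi t.
Proof. by move=> t0; rewrite /Qgain /clamp /= (max_l t0). Qed.

Lemma Qloss_clamp f x xi t : 0 <= t ->
  Qloss (clamp f) (clamp f) x xi t = Qloss f f x xi t.
Proof. by move=> t0; rewrite /Qloss /clamp /= (max_l t0). Qed.

Lemma Q_clamp f x xi t : 0 <= t -> Q (clamp f) (clamp f) x xi t = Q f f x xi t.
Proof.
move=> t0; exact: (congr2 (fun a b => a - b)%E (Qgain_clamp f x xi t0)
  (Qloss_clamp f x xi t0)).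
Qed.

End clamped_time.

Section norms.
Context {R : realType} {n : nat}.
Variable lam : evolution R n.
Hypothesis lam0 : forall x xi t, 0 <= t -> 0 < lam x xi t.

Lemma inS_dominated C f : inS lam C f <-> dominated lam C f.
Proof.
split=> [H x xi t t0|H].
  rewrite -ler_pdivrMr ?lam0// -lee_fin; apply: le_trans H.
  by apply: ereal_sup_ubound; exists (x, xi, t).
apply: ge_ereal_sup => _ [[[x xi] t] /= t0 <-].
by rewrite lee_fin ler_pdivrMr ?lam0//; exact: H.
Qed.

Lemma normO_le h (B : \bar R) :
  (forall x xi, (`|h x xi| * ((lam x xi 0)^-1)%:E <= B)%E)
    -> (normO lam h <= B)%E.
Proof. by move=> H; apply: ge_ereal_sup => _ [[x xi] _ <-]; exact: H. Qed.

Lemma le_normO h x xi : (`|h x xi| * ((lam x xi 0)^-1)%:E <= normO lam h)%E.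
Proof. by apply: ereal_sup_ubound; exists (x, xi). Qed.

Lemma normO_ge0 h : (0 <= normO lam h)%E.
Proof.
apply: le_trans (le_normO h 0 0); apply: mule_ge0 => //.
by rewrite lee_fin invr_ge0 ltW// lam0.
Qed.

(** Testing on the compact set {x} suffices: the triangle inequality bounds the weighted distance at
    x by a sum of two norms tending to 0. *)
Lemma scatters_to_unique f h1 h2 x xi :
  scatters_to lam f h1 -> scatters_to lam f h2 -> h1 x xi 0 = h2 x xi 0.
Proof.
move=> /(_ _ (@compact_set1 _ x)) H1 /(_ _ (@compact_set1 _ x)) H2.
have := cvgeD _ H1 H2; rewrite adde0 => /(_ _ isT) H.
apply/eqP; rewrite -subr_eq0 -normr_le0.
have : (`|h1 x xi 0 - h2 x xi 0|%:E * ((lam x xi 0)^-1)%:E <= 0)%E.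
  apply: cvge_to_ge H _; near=> t => /=.
  apply: le_trans (leeD (le_normO _ x xi) (le_normO _ x xi)).
  rewrite !indicE !mem_set// !mul1r -!EFinM -EFinD lee_fin -mulrDl.
  rewrite ler_wpM2r ?invr_ge0 ?(ltW (lam0 _ _ _))//.
  by rewrite [X in _ <= X + _]distrC; exact: ler_distD.
by rewrite -EFinM lee_fin pmulr_lle0 ?invr_gt0 ?lam0.
Unshelve. all: by end_near. Qed.

End norms.

(** * Scattering solutions relative to a fixed frame *)

Section scattering_theory.
Context {R : realType} {n : nat}.
Variables (lam : evolution R n) (alpha N : R).
Hypothesis frame : scattering_frame lam.
Hypothesis radius : isotropic_radius lam alpha.
Hypothesis N0 : 0 < N.
Hypothesis Nalpha : N < alpha.

(** The estimates ask for measurability at all times, so they are applied to the clamped frame,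
    while norms and [tau] remain those of lam; the two frames agree for t >= 0. *)
Local Notation l := (clamp lam).
Local Notation tail x xi r :=
  (\int[lebesgue_measure]_(s in `[r, +oo[) along (total_collision l) x xi s)%E.
Local Notation tau D r := (tail_sup Qgain lam D r + tail_sup Qloss lam D r)%E.

Let lam0 x xi t : 0 <= t -> 0 < lam x xi t.
Proof. by case: frame => _ + _ _; exact. Qed.

Let lE x xi : l x xi 0 = lam x xi 0. Proof. exact: clampE. Qed.

Let ml : total_measurable l.
Proof. by apply: measurable_clamp; case: frame => -[]. Qed.

Let l0 x xi t : 0 <= t -> 0 < l x xi t.
Proof. by move=> t0; rewrite clampE// lam0. Qed.

Let lT x xi t : 0 <= t -> l (x + t *: xi) xi t = l x xi 0.
Proof. by move=> t0; rewrite !clampE//; case: frame => -[_ H] _ _ _;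
  exact: H. Qed.

Let dominated_clamp C f : dominated l C f <-> inS lam C f.
Proof.
split=> [H|/(inS_dominated lam0) H x xi t t0].
  by apply/(inS_dominated lam0) => x xi t t0; have := H x xi t t0;
    rewrite clampE.
by rewrite clampE//; exact: H.
Qed.

Let tail_sup_ub q D r x xi : 0 <= r ->
  (forall y v s, 0 <= s -> q l l y v s = q lam lam y v s) ->
  ((\1_D x / lam x xi 0)%:E *
    \int[lebesgue_measure]_(s in `[r, +oo[) along (q l l) x xi s
  <= tail_sup q lam D r)%E.
Proof.
move=> r0 qE; apply: ereal_sup_ubound; exists (x, xi) => //=; congr (_ * _)%E.
apply: eq_integral => s /set_mem; rewrite /= in_itv/= andbT => rs.
by rewrite /along qE// (le_trans r0).
Qed.

(** The frame condition takes the suprema of gain and loss separately, so the integral of their sum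
    is split, both being nonnegative. *)
Let tail_le D r x xi : 0 <= r ->
  ((\1_D x / lam x xi 0)%:E * tail x xi r <= tau D r)%E.
Proof.
move=> r0; have r0' (s : R) : `[r, +oo[%classic s -> 0 <= s.
  by rewrite /= in_itv/= andbT; exact: le_trans.
have mG : measurable_fun setT (along (Qgain l l) x xi).
  by apply: (@measurable_along _ _ (fun f => Qgain f f)) => a b c;
    exact: measurable_Qgain.
have mL : measurable_fun setT (along (Qloss l l) x xi).
  by apply: (@measurable_along _ _ (fun f => Qloss f f)) => a b c;
    exact: measurable_Qloss.
have G0 s : 0 <= s -> (0 <= along (Qgain l l) x xi s)%E.
  by move=> s0; apply: Qgain_ge0 => y v; exact: l0.
have L0 s : 0 <= s -> (0 <= along (Qloss l l) x xi s)%E.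
  by move=> s0; apply: Qloss_ge0 => y v; exact: l0.
have -> : tail x xi r = (\int[lebesgue_measure]_(s in `[r, +oo[)
  along (Qgain l l) x xi s
    + \int[lebesgue_measure]_(s in `[r, +oo[) along (Qloss l l) x xi s)%E.
  apply: (@ge0_integralD _ _ _ lebesgue_measure `[r, +oo[ _
    (along (Qgain l l) x xi) (along (Qloss l l) x xi)); first by [].
  - by move=> s /r0'; exact: G0.
  - exact: measurable_funTS mG.
  - by move=> s /r0'; exact: L0.
  - exact: measurable_funTS mL.
rewrite ge0_muleDr; last 2 first.
- by apply: integral_ge0 => s /r0'; exact: G0.
- by apply: integral_ge0 => s /r0'; exact: L0.
apply: leeD; apply: (tail_sup_ub _ _ _ r0) => y v s s0.
  exact: Qgain_clamp.
exact: Qloss_clamp.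
Qed.

Let lI x xi : (tail x xi 0%R <= ((2 * alpha)^-1 * l x xi 0)%:E)%E.
Proof.
(* For D the whole space and r = 0, [tau] is [collision_sup], that is (2 alpha)^-1. *)
have := tail_le setT x xi (lexx 0); rewrite -/(collision_sup lam) -radius.2.
by rewrite indicT mul1r lee_pdivrMl ?lam0// -EFinM lE mulrC.
Qed.

Lemma squeeze_tail D (h : R -> \bar R) : bounded_set D ->
  (forall r, 0 <= r -> (0 <= h r <= (N ^+ 2)%:E * tau D r)%E) ->
  h r @[r --> +oo] --> 0%E.
Proof.
move=> bD hD; apply: (@squeeze_cvge _ _ _ _ (fun=> 0%E) h (fun r =>
  (N ^+ 2)%:E * tau D r)%E).
- near=> r; apply: hD; near: r; exact: nbhs_pinfty_ge.
- exact: cvg_cst.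
- rewrite -(mule0 (N ^+ 2)%:E); apply: cvgeZl => //.
  by case: frame => _ _ _; exact.
Unshelve. all: by end_near. Qed.

Let normO_tau D r (h : 'rV[R]_n -> 'rV[R]_n -> \bar R) : 0 <= r ->
  (forall x xi, (`|h x xi| <= (\1_D x)%:E * ((N ^+ 2)%:E * tail x xi r))%E) ->
  (0 <= normO lam h <= (N ^+ 2)%:E * tau D r)%E.
Proof.
move=> r0 hD; rewrite normO_ge0//=; apply: normO_le => x xi.
have lV : 0 <= (lam x xi 0)^-1 by rewrite invr_ge0 ltW// lam0.
apply: le_trans (lee_wpmul2r _ (hD x xi)) _; first by rewrite lee_fin.
have -> : ((\1_D x)%:E * ((N ^+ 2)%:E * tail x xi r) * ((lam x xi 0)^-1)%:E =
    (N ^+ 2)%:E * ((\1_D x / lam x xi 0)%:E * tail x xi r))%E.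
  by rewrite muleCA -muleA; congr (_ * _)%E; rewrite muleAC -EFinM.
by rewrite lee_wpmul2l ?lee_fin ?exprn_ge0 ?(ltW N0)//; exact: tail_le.
Qed.

Lemma dominated_scattering f : total_measurable f -> dominated l N f ->
  boltzmann_solution f -> scattering_solution lam f.
Proof.
move=> mf fN fB; split => //.
  apply: (@le_lt_trans _ _ (N%:E + (N ^+ 2)%:E * ((2 * alpha)^-1)%:E)%E);
    last first.
    by rewrite -EFinM -EFinD ltry.
  apply: leeD.
    apply: normO_le => x xi; rewrite -EFinM lee_fin ler_pdivrMr ?lam0// -lE.
    exact: fN.
  apply: normO_le => x xi.
  rewrite gee0_abs; last by apply: integral_ge0.
  have := abs_collision_tail_le ml l0 N0 mf fN x xi (lexx 0) => H.
  apply: le_trans (lee_wpmul2r _ H) _;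
    first by rewrite lee_fin invr_ge0 ltW// lam0.
  rewrite -muleA lee_wpmul2l ?lee_fin ?exprn_ge0 ?(ltW N0)//.
  rewrite muleC lee_pdivrMl ?lam0//; apply: le_trans (lI x xi) _.
  by rewrite lE -EFinM mulrC.
move=> D bD; apply: (squeeze_tail bD) => r r0; apply: (normO_tau r0) => x xi.
rewrite abseM /= ger0_norm// lee_wpmul2l ?lee_fin//.
rewrite gee0_abs; last by apply: integral_ge0.
exact: (abs_collision_tail_le ml l0 N0 mf fN).
Qed.

Section construction.
Variables (g0 : 'rV[R]_n -> 'rV[R]_n -> R) (z : R).
Hypothesis mg0 : measurable_fun setT (fun p : 'rV[R]_n * 'rV[R]_n =>
  g0 p.1 p.2).
Hypothesis g0N : forall x xi, `|g0 x xi| <= 2^-1 * N * lam x xi 0.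
Hypothesis z0 : 0 <= z.

Let g0Nl x xi : `|g0 x xi| <= 2^-1 * N * l x xi 0.
Proof. by rewrite lE. Qed.

(** Serves both halves of the theorem. The fixed-point equation is kept for uniqueness in the first,
    the distance from g0 to the limit for the convergence in z in the second. *)
Lemma scattering_existence : exists f h : evolution R n,
  [/\ total_measurable f, scattering_solution lam f, inS lam N f &
      forall x xi t, 0 <= t -> f x xi t = duhamel g0 z f x xi t] /\
  [/\ transport_solution h, inS lam N h, scatters_to lam f h &
      forall x xi, (`|(g0 x xi - h x xi 0)%:E| <= (N ^+ 2)%:E * tail x xi z)%E].
Proof.
have [f [mf fN fE]] := duhamel_fixpoint ml l0 lT lI N0 Nalpha z mg0 g0Nl.
have fB := fixpoint_boltzmann ml l0 lI N0 mf fN fE.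
pose F := outgoing g0 z f.
(* The outgoing profile, extended to be constant along characteristics. *)
pose h : evolution R n := fun x xi t => F (x - t *: xi) xi.
have h0 x xi : h x xi 0 = F x xi by rewrite /h scale0r subr0.
exists f, h; split; split.
- exact: mf.
- exact: dominated_scattering.
- exact/dominated_clamp.
- exact: fE.
- split.
    apply: measurable_funTS; rewrite /h.
    have mF : measurable_fun setT (fun p : 'rV[R]_n * 'rV[R]_n => F p.1 p.2).
      exact: measurable_outgoing.
    pose P := ('rV[R]_n * 'rV[R]_n * R)%type.
    apply: (measurableT_comp mF (g := fun p : P =>
      (p.1.1 - p.2 *: p.1.2, p.1.2))).
    have mxi : measurable_fun setT (fun p : P => p.1.2).
      exact: measurableT_comp measurable_snd measurable_fst.
    apply: measurable_fun_pair => //; apply: measurable_rvB.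
      exact: measurableT_comp measurable_fst measurable_fst.
    by apply: measurable_rvZ => //; exact: measurable_snd.
  by move=> x xi t _; rewrite h0 /h addrK.
- apply/dominated_clamp/(dominatedP lT) => x xi t t0; rewrite /h addrK.
  exact: (outgoing_dominated ml l0 lI N0 Nalpha z g0Nl mf fN).
- move=> D cD; apply: (squeeze_tail (compact_bounded cD)) => t t0.
  apply: (normO_tau t0) => x xi; rewrite h0 EFinM abseM.
  rewrite [X in (X * _)%E]gee0_abs ?lee_fin// lee_wpmul2l ?lee_fin//.
  exact: (outgoing_limit ml l0 lI N0 mf fN _ _ t0 fE).
- by move=> x xi; rewrite h0; exact: (outgoing_initial ml l0 lI N0 g0 mf fN).
Qed.

End construction.

(** In integrated form g is a fixed point for z = 0 lying in S(N), and there is only one. *)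
Lemma scattering_unique (f0 : 'rV[R]_n -> 'rV[R]_n -> R) f g :
  total_measurable f -> inS lam N f ->
  (forall x xi, `|f0 x xi| <= 2^-1 * N * lam x xi 0) ->
  (forall x xi t, 0 <= t -> f x xi t = duhamel f0 0 f x xi t) ->
  boltzmann_solution g -> inS lam N g -> (forall x xi, g x xi 0 = f0 x xi) ->
  eq_evolution f g.
Proof.
move=> mf /dominated_clamp fN f0N fE [mg gB] /dominated_clamp gN g0.
have mc := measurable_clamp mg.
have cN : dominated l N (clamp g).
  by move=> x xi t t0; rewrite clampE//; exact: gN.
have cE x xi t : 0 <= t -> clamp g x xi t = duhamel f0 0 (clamp g) x xi t.
  move=> t0; rewrite -[x](subrK (t *: xi)); move: (x - t *: xi) => y.
  rewrite clampE// duhamel_along//.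
  have WE : weighted_collision (window t 0) (clamp g) y xi =
      (\int[lebesgue_measure]_(s in `[0%R, t]) along (Q g g) y xi s)%E.
    rewrite (weighted_collision_window _ _ _ _ ml l0 lI N0 mc cN).
    (* [window t 0] differs from the indicator of [0, t] only at s = 0, a null set. *)
    rewrite [X in (_ - X)%E](_ : _ = 0%E);
      last by rewrite set_itv1 integral_set1.
    rewrite sube0; apply: eq_integral => s /set_mem.
    by rewrite /= in_itv/= => /andP[s0 _]; exact: Q_clamp.
  have := weighted_collision_fin ml l0 lI N0 mc cN y xi (measurable_window t 0)
    (window_abs t 0).
  rewrite WE => /fineK FI; apply: EFin_inj; have [_ ->] := gB y xi t t0.
  by rewrite g0 EFinD FI.
have fg := duhamel_unique ml l0 lT lI N0 Nalpha mf mc fN cN fE cE.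
by move=> x xi t t0; rewrite fg// clampE.
Qed.

Lemma scattering_limit_unique (f h : evolution R n)
  : transport_solution h -> inS lam N h ->
  scatters_to lam f h ->
  unique_evolution (fun g => [/\ transport_solution g, inS lam N g &
                                  scatters_to lam f g]) h.
Proof.
move=> hT hN fh; split=> [//|g [gT _ fg] x xi t t0].
rewrite -[x](subrK (t *: xi)) hT.2// gT.2//.
exact: (scatters_to_unique lam0 _ _ fh fg).
Qed.

(** Both solutions and the frame are constant along characteristics, and x - t xi is the foot of the
    one through x; the scattering norm thus reduces to the observer's norm at time 0. *)
Lemma normS_transport_diff (g h : evolution R n)
  D z : transport_solution g -> transport_solution h ->
  0 <= z ->
  (forall x xi, (`|(g x xi 0 - h x xi 0)%:E| <= (N ^+ 2)%:E * tail x xi z)%E) ->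
  (0 <= normS lam (fun x xi t => \1_D (x - t *: xi) * (g x xi t - h x xi t))%R
     <= (N ^+ 2)%:E * tau D z)%E.
Proof.
move=> gT hT z0 gh; apply/andP; split.
  apply: (@le_trans _ _ (`|\1_D (0 - 0 *: 0)%R * (g 0%R 0%R 0%R - h 0%R 0%R
    0%R)| / lam 0%R 0%R 0%R)%:E).
    by rewrite lee_fin divr_ge0// ltW// lam0.
  by apply: ereal_sup_ubound; exists (0, 0, 0) => //=.
apply: ge_ereal_sup => _ [[[x xi] t] /= t0 <-].
rewrite -[x](subrK (t *: xi)) addrK; move: (x - t *: xi) => {}x.
rewrite gT.2// hT.2//.
have -> : lam (x + t *: xi) xi t = lam x xi 0.
  by case: frame => -[_ H] _ _ _; exact: H.
have /andP[_] : (0 <= normO lam (fun y v => (\1_D y * (g y v 0 - h y v 0))%:E)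
    <= (N ^+ 2)%:E * tau D z)%E.
  apply: normO_tau => // y v; rewrite EFinM abseM.
  by rewrite [X in (X * _)%E]gee0_abs ?lee_fin// lee_wpmul2l ?lee_fin.
apply: le_trans; apply: le_trans (le_normO lam _ x xi).
by rewrite abse_EFin -EFinM.
Qed.

End scattering_theory.

Theorem theorem4p1 (R : realType) (n : nat) (hn : (0 < n)%N)
    (lam : evolution R n) (alpha N : R) (hlam : scattering_frame lam)
    (halpha : isotropic_radius lam alpha) (hN0 : 0 < N) (hNalpha : N < alpha) :
  (forall f0 : 'rV[R]_n -> 'rV[R]_n -> R,
    finite_mass_energy_momentum f0 ->
    inS lam (2^-1 * N) (fun x xi t => f0 (x - t *: xi) xi) ->
    exists f : evolution R n,
      unique_evolution
        (fun g => [/\ scattering_solution lam g, inS lam N g &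
                      forall x xi, g x xi 0 = f0 x xi]) f /\
      exists finf : evolution R n,
        unique_evolution
          (fun g => [/\ transport_solution g, inS lam N g &
                        scatters_to lam f g]) finf)
  /\
  (forall finf : evolution R n,
    transport_solution finf -> inS lam (2^-1 * N) finf ->
    exists (u : R -> evolution R n) (finfz : R -> evolution R n),
      (forall z : R, 0 <= z ->
        [/\ scattering_solution lam (u z), inS lam N (u z) &
            unique_evolution
              (fun g => [/\ transport_solution g, inS lam N g &
                            scatters_to lam (u z) g]) (finfz z)]) /\
      (forall D : set 'rV[R]_n, compact D ->
        normS lam (fun x xi t =>
            \1_D (x - t *: xi) * (finf x xi t - finfz z x xi t))
          @[z --> +oo] --> 0%E)).
Proof.
have lam0 x xi t : 0 <= t -> 0 < lam x xi t by case: hlam => _ + _ _; exact.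
split.
  (* Measurability of f0 is read off the convergence of its mass. *)
  move=> f0 [/integrableP[/measurable_EFinP mf0 _] _ _] /(inS_dominated lam0)
    f0N.
  have f0N0 x xi : `|f0 x xi| <= 2^-1 * N * lam x xi 0.
    by have := f0N x xi 0 (lexx 0); rewrite scale0r subr0.
  have [f [h [[mf fS fN fE] [hT hN fh _]]]] :=
    scattering_existence hlam halpha hN0 hNalpha mf0 f0N0 (lexx 0).
  exists f; split.
    split.
      split => // x xi; by rewrite fE// duhamel_initial.
    move=> g [[gB _ _] gN g0].
    exact: (scattering_unique hlam halpha hN0 hNalpha mf fN f0N0 fE gB gN g0).
  by exists h; exact: (scattering_limit_unique hlam).
move=> finf finfT /(inS_dominated lam0) finfN.
have g0N x xi : `|finf x xi 0| <= 2^-1 * N * lam x xi 0 by exact: finfN.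
have mg0 : measurable_fun setT (fun p : 'rV[R]_n * 'rV[R]_n => finf p.1 p.2 0).
  have mc := measurable_clamp finfT.1.
  have := measurable_evolution_comp mc (@measurable_fst _ _ _ _)
    (@measurable_snd _ _ _ _) (measurable_cst (0 : R)).
  by under eq_fun do rewrite clampE//.
(* Solution and limit are chosen as one pair, with the bounds for all D at once, so that the pair
   depends on z alone. *)
have /choice[uh uhP] : forall z : R,
  exists uh : evolution R n * evolution R n, 0 <= z ->
  [/\ scattering_solution lam uh.1, inS lam N uh.1 &
    unique_evolution (fun g => [/\ transport_solution g, inS lam N g &
                            scatters_to lam uh.1 g]) uh.2] /\
  forall D, (0 <= normS lam (fun x xi t =>
            \1_D (x - t *: xi) * (finf x xi t - uh.2 x xi t))%R
     <= (N ^+ 2)%:E * (tail_sup Qgain lam D z + tail_sup Qloss lam D z))%E.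
  (* Nothing is claimed for z < 0, where any pair will do. *)
  move=> z; case: (leP 0 z) => z0; last by exists (lam, lam).
  have [u [h [[mu uS uN uE] [hT hN uh hB]]]] :=
    scattering_existence hlam halpha hN0 hNalpha mg0 g0N z0.
  exists (u, h) => _; split.
    by split => //; exact: (scattering_limit_unique hlam).
  move=> D; exact: (normS_transport_diff hlam hN0 D finfT hT z0 hB).
exists (fun z => (uh z).1), (fun z => (uh z).2); split => [z z0|D cD].
  by have [] := uhP z z0.
apply: (squeeze_tail (N := N) hlam (compact_bounded cD)) => z z0.
by have [_] := uhP z z0; exact.
Qed.
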